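(* Let $V\subset\mathbb{R}^3$ be the standard tropical hyperplane, i.e. the two dimensional fan whose facets, all of weight $1$, are the six cones spanned by pairs of the vectors $(1,1,1),(-1,0,0),(0,-1,0),(0,0,-1)$. For an integer $d\ge1$ let $B\subset V$ be the one dimensional tropical cycle that is the union of the three rays spanned by $$(0,1,1),\qquad(1-d,-d,0),\qquad(d-1,d-1,-1),$$ each with weight $1$. If $d\ge3$, then $B\subset V$ is not realisable over any field.
   Context: ''$B\subset V$ is realisable over a field $\mathbf{k}$'' means: with $\mathbf{K}$ the field of Puiseux series with coefficients in $\mathbf{k}$ (algebraically closed), there exist a plane $\mathbf{V}\subset(\mathbf{K}^* )^3$ (a two dimensional subvariety defined by linear equations) with $\mathrm{Trop}(\mathbf{V})=V$ and an algebraic curve $\mathbf{C}\subset\mathbf{V}$ with $\mathrm{Trop}(\mathbf{C})=B$. Here $\mathrm{Trop}$ denotes tropicalisation with its positive integer weights, in the max convention. ''Not realisable over any field'' means that no such pair exists for any $\mathbf{k}$ (of any characteristic). *)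

(* Defs.v *)
From HB Require Import structures.
From mathcomp Require Import all_boot all_order all_algebra finmap.
From mathcomp Require Import ring lra.
From mathcomp Require Import all_classical all_reals.

Set Implicit Arguments.
Unset Strict Implicit.
Unset Printing Implicit Defensive.

Import Order.TTheory GRing.Theory Num.Theory.
Local Open Scope classical_set_scope.
Local Open Scope ring_scope.

(* Both the Puiseux series (exponents in rat) and the Laurent polynomials
   (exponents in Z^n) are functions from an abelian group of exponents to a
   coefficient ring, with a restricted support, multiplied by convolution. The
   axioms below are what the convolution product needs. *)
Record supports (G : zmodType) := Supports {
  supp_ok :> set G -> Prop;
  supp_ok_sub : forall X Y, X `<=` Y -> supp_ok Y -> supp_ok X;
  supp_ok1 : forall u, supp_ok [set u];
  supp_okU : forall X Y, supp_ok X -> supp_ok Y -> supp_ok (X `|` Y);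
  supp_okD : forall X Y, supp_ok X -> supp_ok Y ->
    supp_ok [set x + y | x in X & y in Y];
  supp_ok_fin : forall X Y, supp_ok X -> supp_ok Y ->
    forall z, finite_set [set x | X x /\ Y (z - x)] }.

Definition supp (G : Type) (A : nmodType) (f : G -> A) : set G :=
  [set x | f x != 0].

Record series (G : zmodType) (S : supports G) (A : nmodType) := Series {
  coef :> G -> A;
  coefP : S (supp coef) }.

Section SeriesRing.
Context (G : zmodType) (S : supports G).

Section Additive.
Context (A : zmodType).
Implicit Types f g h : series S A.

Lemma seriesP f g : (forall x, f x = g x) -> f = g.
Proof.
case: f g => f Sf [g Sg] /= /funext fg; subst g.
by congr Series; exact: Prop_irrelevance.
Qed.

HB.instance Definition _ := gen_eqMixin (series S A).
HB.instance Definition _ := gen_choiceMixin (series S A).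

Lemma zero_subproof : S (supp (fun=> 0 : A)).
Proof. by apply: supp_ok_sub (supp_ok1 S 0) => x; rewrite /supp /= eqxx. Qed.

Lemma add_subproof f g : S (supp (fun x => f x + g x)).
Proof.
apply: supp_ok_sub (supp_okU (coefP f) (coefP g)) => x; rewrite /supp /=.
have [->|] := eqVneq (f x) 0; last by left.
by rewrite add0r; right.
Qed.

Lemma opp_subproof f : S (supp (fun x => - f x)).
Proof. by apply: supp_ok_sub (coefP f) => x; rewrite /supp /= oppr_eq0. Qed.

Definition series_zero : series S A := Series zero_subproof.
Definition series_add f g : series S A := Series (add_subproof f g).
Definition series_opp f : series S A := Series (opp_subproof f).

Fact series_addA : associative series_add.
Proof. by move=> f g h; apply: seriesP => x /=; rewrite addrA. Qed.
Fact series_addC : commutative series_add.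
Proof. by move=> f g; apply: seriesP => x /=; rewrite addrC. Qed.
Fact series_add0 : left_id series_zero series_add.
Proof. by move=> f; apply: seriesP => x /=; rewrite add0r. Qed.
Fact series_addN : left_inverse series_zero series_opp series_add.
Proof. by move=> f; apply: seriesP => x /=; rewrite addNr. Qed.

HB.instance Definition _ := GRing.isZmodule.Build (series S A)
  series_addA series_addC series_add0 series_addN.

Lemma coef0 x : (0 : series S A) x = 0. Proof. by []. Qed.
Lemma coefD f g x : (f + g) x = f x + g x. Proof. by []. Qed.
Lemma coefN f x : (- f) x = - f x. Proof. by []. Qed.

Lemma mono_subproof (c : A) (u : G) :
  S (supp (fun x => if x == u then c else 0)).
Proof.
apply: supp_ok_sub (supp_ok1 S u) => x; rewrite /supp /=.
by have [->//|_] := eqVneq x u; rewrite eqxx.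
Qed.

Definition mono (c : A) (u : G) : series S A := Series (mono_subproof c u).

End Additive.

Section Mult.
Context (A : comNzRingType).
Implicit Types f g h : series S A.

Definition conv (f g : G -> A) (x : G) : A := \sum_(y \in [set: G]) f y * g (x - y).

Lemma conv_support f g x :
  finite_set [set y | f y != 0 /\ g (x - y) != 0].
Proof. exact: supp_ok_fin (coefP f) (coefP g) x. Qed.

Lemma convE (f g : G -> A) x (X : {fset G}) :
    (forall y, f y != 0 -> g (x - y) != 0 -> y \in X) ->
  conv f g x = \sum_(y <- X) f y * g (x - y).
Proof.
move=> fgX; apply: fsbigTE => y; apply: contraNeq => fg0.
apply: fgX; apply: contraNneq fg0 => ->; rewrite ?mul0r ?mulr0 ?eqxx //.
Qed.

Lemma conv_neq0 (f g : G -> A) x : conv f g x != 0 ->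
  exists2 a, f a != 0 & exists2 b, g b != 0 & a + b = x.
Proof.
apply: contraNP => fg0; apply/eqP; apply: fsbig1 => y _.
have [->|fy] := eqVneq (f y) 0; first by rewrite mul0r.
have [->|gy] := eqVneq (g (x - y)) 0; first by rewrite mulr0.
by case: fg0; exists y => //; exists (x - y) => //; rewrite addrC subrK.
Qed.

Lemma conv_subproof f g : S (supp (conv f g)).
Proof. by apply: supp_ok_sub (supp_okD (coefP f) (coefP g)) => x /conv_neq0. Qed.

Definition series_one : series S A := mono 1 0.
Definition series_mul f g : series S A := Series (conv_subproof f g).

Fact series_mulA : associative series_mul.
Proof.
move=> f g h; apply: seriesP => x /=.
have Sfg := supp_okD (coefP f) (coefP g).
have Sgh := supp_okD (coefP g) (coefP h).
have /finite_fsetP[Z ZE] := supp_ok_fin (coefP f) Sgh x.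
have /finite_fsetP[Y YE] := supp_ok_fin Sfg (coefP h) x.
have ZP z : [/\ f z != 0 & (exists2 a, g a != 0 & exists2 b, h b != 0 & a + b = x - z)]
    -> z \in Z.
  by move=> [fz H]; have /= <- := congr1 (@^~ z) ZE; split.
have YP y : [/\ h (x - y) != 0 & (exists2 a, f a != 0 & exists2 b, g b != 0 & a + b = y)]
    -> y \in Y.
  by move=> [hz H]; have /= <- := congr1 (@^~ y) YE; split.
rewrite (@convE f _ x Z); last first.
  by move=> y fy /conv_neq0 ghy; apply: ZP.
rewrite (@convE _ h x Y); last first.
  by move=> y /conv_neq0 fgy hy; apply: YP.
transitivity (\sum_(z <- Z) \sum_(y <- Y) f z * g (y - z) * h (x - y)).
  apply: eq_bigr => z _; have [->|fz] := eqVneq (f z) 0.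
    by rewrite mul0r big1 // => y _; rewrite !mul0r.
  rewrite (_ : conv g h (x - z) = \sum_(y <- Y) g (y - z) * h (x - y)).
    by rewrite mulr_sumr; apply: eq_bigr => y _; rewrite mulrA.
  rewrite /conv (reindex_fsbigT (fun y => y - z)); last first.
    by exists (fun y => y + z) => y; rewrite ?addrK ?subrK.
  rewrite (fsbigTE Y); first by apply: eq_bigr => y _; rewrite opprB addrA subrK.
  move=> y; rewrite opprB addrA subrK; apply: contraNeq => gh0; apply: YP.
  split; first by apply: contraNneq gh0 => ->; rewrite mulr0.
  exists z => //; exists (y - z); last by rewrite addrC subrK.
  by apply: contraNneq gh0 => ->; rewrite mul0r.
rewrite exchange_big /=; apply: eq_bigr => y _.
have [->|hy] := eqVneq (h (x - y)) 0.
  by rewrite mulr0 big1 // => z _; rewrite mulr0.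
rewrite -mulr_suml (@convE f g y Z) // => z fz gyz; apply: ZP; split=> //.
by exists (y - z) => //; exists (x - y) => //; rewrite addrC addrA subrK.
Qed.

Fact series_mulC : commutative series_mul.
Proof.
move=> f g; apply: seriesP => x /=; rewrite /conv.
rewrite (reindex_fsbigT (fun y => x - y)); last first.
  by exists (fun y => x - y) => y; rewrite subKr.
by apply: eq_fsbigr => y _; rewrite subKr mulrC.
Qed.

Fact series_mul1 : left_id series_one series_mul.
Proof.
move=> f; apply: seriesP => x /=; rewrite (@convE _ f x [fset 0]%fset).
  by rewrite big_seq_fset1 /= eqxx mul1r subr0.
by move=> y /=; rewrite inE; case: (y == 0) => //; rewrite eqxx.
Qed.

Fact series_mulDl : left_distributive series_mul (@series_add A).
Proof.
move=> f g h; apply: seriesP => x /=.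
have /finite_fsetP[X XE] := conv_support f h x.
have /finite_fsetP[Y YE] := conv_support g h x.
have XP y : f y != 0 -> h (x - y) != 0 -> y \in (X `|` Y)%fset.
  by move=> fy hy; rewrite inE; apply/orP; left; have /= <- := congr1 (@^~ y) XE; split.
have YP y : g y != 0 -> h (x - y) != 0 -> y \in (X `|` Y)%fset.
  by move=> fy hy; rewrite inE; apply/orP; right; have /= <- := congr1 (@^~ y) YE; split.
rewrite (@convE f h x (X `|` Y)%fset) // (@convE g h x (X `|` Y)%fset) //.
rewrite (@convE _ h x (X `|` Y)%fset).
  by rewrite -big_split; apply: eq_bigr => y _; rewrite mulrDl.
move=> y /= fg hy; have [fy|] := eqVneq (f y) 0; last by move=> /XP; apply.
by apply: YP => //; rewrite fy add0r in fg.
Qed.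

Fact series_one_neq0 : series_one != 0.
Proof.
apply/eqP => /(congr1 (fun f : series S A => f 0)) /eqP /=.
by rewrite eqxx oner_eq0.
Qed.

HB.instance Definition _ := GRing.Zmodule_isComNzRing.Build (series S A)
  series_mulA series_mulC series_mul1 series_mulDl series_one_neq0.

Lemma coefM f g x : (f * g) x = \sum_(y \in [set: G]) f y * g (x - y).
Proof. by []. Qed.
Lemma coef1 x : (1 : series S A) x = (x == 0)%:R.
Proof. by rewrite /= ; case: (x == 0). Qed.

End Mult.
End SeriesRing.

Definition laurent_ok (n : nat) (X : set 'rV[int]_n) : Prop := finite_set X.

Fact laurent_ok_fin n (X Y : set 'rV[int]_n) : laurent_ok X -> laurent_ok Y ->
  forall z, finite_set [set x | X x /\ Y (z - x)].
Proof. by move=> fX _ z; apply: sub_finite_set fX => x []. Qed.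

Fact laurent_okU n (X Y : set 'rV[int]_n) :
  laurent_ok X -> laurent_ok Y -> laurent_ok (X `|` Y).
Proof. by move=> fX fY; rewrite /laurent_ok finite_setU. Qed.

Fact laurent_okD n (X Y : set 'rV[int]_n) : laurent_ok X -> laurent_ok Y ->
  laurent_ok [set x + y | x in X & y in Y].
Proof. exact: finite_image2. Qed.

Definition laurent_supports n : supports 'rV[int]_n :=
  Supports (supp_ok := @laurent_ok n) (fun X Y => @sub_finite_set _ X Y)
    (@finite_set1 _) (@laurent_okU n) (@laurent_okD n) (@laurent_ok_fin n).

Notation laurent n A := (series (laurent_supports n) A).

(* The exponents of a Puiseux series have a common denominator N and are
   bounded below. *)
Definition puiseux_ok (X : set rat) : Prop :=
  exists N m : nat, (0 < N)%N /\
    forall q, X q -> exists i : nat, q = (i%:R - m%:R) / N%:R.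

Fact puiseux_ok_sub X Y : X `<=` Y -> puiseux_ok Y -> puiseux_ok X.
Proof. by move=> XY [N [m [N0 Ym]]]; exists N, m; split=> // q /XY /Ym. Qed.

Fact puiseux_ok1 (u : rat) : puiseux_ok [set u].
Proof.
exists `|denq u|%N, `|numq u|%N; split; first by rewrite absz_gt0 denq_neq0.
move=> _ ->; exists `|(numq u + `|numq u|%N)%R|%N.
have := ler_norm (- numq u); rewrite normrN lerNl -subr_ge0 opprK => hu.
rewrite !natr_absz (ger0_norm hu) (gtr0_norm (denq_gt0 u)).
by rewrite intrD addrK divq_num_den.
Qed.

Fact puiseux_ok_common X Y : puiseux_ok X -> puiseux_ok Y ->
  exists N m m' : nat, [/\ (0 < N)%N,
    forall q, X q -> exists i : nat, q = (i%:R - m%:R) / N%:R &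
    forall q, Y q -> exists i : nat, q = (i%:R - m'%:R) / N%:R].
Proof.
move=> [N [m [N0 Xm]]] [N' [m' [N0' Ym]]].
have nN : N%:R != 0 :> rat by rewrite pnatr_eq0 -lt0n.
have nN' : N'%:R != 0 :> rat by rewrite pnatr_eq0 -lt0n.
exists (N * N')%N, (m * N')%N, (m' * N)%N; split.
- by rewrite muln_gt0 N0.
- by move=> _ /Xm[i ->]; exists (i * N')%N; rewrite !natrM; field; rewrite nN nN'.
- by move=> _ /Ym[i ->]; exists (i * N)%N; rewrite !natrM; field; rewrite nN nN'.
Qed.

Fact puiseux_okU X Y : puiseux_ok X -> puiseux_ok Y -> puiseux_ok (X `|` Y).
Proof.
move=> /puiseux_ok_common/[apply] -[N [m [m' [N0 Xm Ym]]]].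
exists N, (m + m')%N; split=> // q [/Xm[i ->]|/Ym[i ->]].
- by exists (i + m')%N; rewrite !natrD; congr (_ / _); ring.
- by exists (i + m)%N; rewrite !natrD; congr (_ / _); ring.
Qed.

Fact puiseux_okD X Y : puiseux_ok X -> puiseux_ok Y ->
  puiseux_ok [set x + y | x in X & y in Y].
Proof.
move=> /puiseux_ok_common/[apply] -[N [m [m' [N0 Xm Ym]]]].
exists N, (m + m')%N; split=> // _ [_ /Xm[i ->] [_ /Ym[j ->] <-]].
by exists (i + j)%N; rewrite !natrD -mulrDl; congr (_ / _); ring.
Qed.

Fact puiseux_ok_fin X Y : puiseux_ok X -> puiseux_ok Y ->
  forall z, finite_set [set x | X x /\ Y (z - x)].
Proof.
move=> /puiseux_ok_common/[apply] -[N [m [m' [N0 Xm Ym]]]] z.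
have nN : (0 : rat) < N%:R by rewrite ltr0n.
pose b := Num.bound (N%:R * z + m%:R + m'%:R).
apply: (@sub_finite_set _ _ [set (i%:R - m%:R) / N%:R | i in `I_b]); last first.
  exact/finite_image/finite_II.
move=> _ [/Xm[i ->] /Ym[j jE]]; exists i => //=.
have zE : N%:R * z + m%:R + m'%:R = (i + j)%:R.
  rewrite -[z](subrK ((i%:R - m%:R) / N%:R)) jE natrD; field.
  by rewrite gt_eqF.
by rewrite -(ltr_nat rat) /b zE; apply: le_lt_trans (archi_boundP _);
   rewrite ?ler0n // ler_nat leq_addr.
Qed.

Definition puiseux_supports : supports rat :=
  Supports puiseux_ok_sub puiseux_ok1 puiseux_okU puiseux_okD puiseux_ok_fin.

Notation puiseux k := (series puiseux_supports k).

Section PuiseuxField.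
Context (k : fieldType).

Lemma power_series_inv (b : nat -> k) : b 0 != 0 ->
  exists c : nat -> k, forall n, \sum_(j < n.+1) b j * c (n - j)%N = (n == 0)%:R.
Proof.
move=> b0.
pose next (s : seq k) := ((size s == 0)%:R
  - \sum_(j < size s) b j.+1 * s`_(size s - j.+1)%N) / b 0.
pose cs := fix cs n := if n is m.+1 then rcons (cs m) (next (cs m)) else [::].
have szcs n : size (cs n) = n by elim: n => //= n IH; rewrite size_rcons IH.
pose c n := next (cs n).
have csE n j : (j < n)%N -> (cs n)`_j = c j.
  elim: n => //= n IH; rewrite ltnS nth_rcons szcs leq_eqVlt.
  by case: ltngtP => // [/IH //|->].
exists c => n; rewrite big_ord_recl subn0 {1}/c /next szcs mulrC divfK //.
apply/eqP; rewrite addrAC subr_eq; apply/eqP; congr (_ + _).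
apply: eq_bigr => j _; rewrite /= csE //.
by rewrite ltn_subrL (leq_trans _ (ltn_ord j)).
Qed.

Lemma puiseux_inv (f : puiseux k) : f != 0 -> exists g : puiseux k, g * f = 1.
Proof.
move=> f0; have [N [m [N0 Xm]]] := coefP f.
have nN : N%:R != 0 :> rat by rewrite pnatr_eq0 -lt0n.
pose E (q : rat) := q / N%:R.
have Einj : injective E by move=> x y /(mulIf (invr_neq0 nN)).
have /ex_minnP[i0 ai0 i0_min] : exists i : nat, f (E (i%:R - m%:R)) != 0.
  apply: contrapT => H; move/eqP: f0; apply; apply: seriesP => q /=.
  apply: contrapT => /eqP fq; apply: H; have [i qE] := Xm q fq.
  by exists i; rewrite /E -qE.
pose b j := f (E ((j + i0)%:R - m%:R)).
have [c cP] := @power_series_inv b ai0.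
pose gz q : rat := q * N%:R + i0%:R - m%:R.
pose gf q := if gz q \is a Num.nat then c (Num.truncn (gz q)) else 0.
have gP : puiseux_supports (supp gf).
  exists N, i0; split=> // q; rewrite /supp /= /gf.
  case: ifP => [/natrP[j jE] _|]; last by rewrite eqxx.
  exists (j + m)%N.
  apply: (mulIf nN); rewrite divfK // natrD -jE /gz; ring.
exists (Series gP); rewrite mulrC; apply: seriesP => x; rewrite coefM coef1 /=.
have gE j' : gf (E (j'%:R + m%:R - i0%:R)) = c j'.
  have e : gz (E (j'%:R + m%:R - i0%:R)) = j'%:R.
    rewrite /gz /E divfK //; ring.
  by rewrite /gf e natrK natr_nat.
have fgP y : f y * gf (x - y) != 0 -> exists j j' : nat,
    y = E ((j + i0)%:R - m%:R) /\ x = E (j + j')%:R.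
  move=> fg; have fy : f y != 0 by apply: contraNneq fg => ->; rewrite mul0r.
  have gy : gf (x - y) != 0 by apply: contraNneq fg => ->; rewrite mulr0.
  have [i yE] := Xm y fy; have i0i : (i0 <= i)%N.
    by apply: i0_min; rewrite /E -yE.
  move: gy; rewrite /gf; case: ifP => [/natrP[j' jE] _|]; last by rewrite eqxx.
  exists (i - i0)%N, j'; rewrite subnK //; split=> //.
  apply: (mulIf nN); rewrite divfK // natrD natrB // -jE /gz.
  by rewrite yE; field.
have [[n xE]|xN] := pselect (exists n : nat, x = E n%:R); last first.
  rewrite fsbig1; last first.
    move=> y _; apply: contrapT => /eqP/fgP[j [j' [_ xE]]].
    by apply: xN; exists (j + j')%N.
  case: eqP => // x0; case: xN; exists 0%N.
  by rewrite x0 /E mul0r.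
pose r := [seq E ((j + i0)%:R - m%:R) | j <- iota 0 n.+1].
rewrite (fsbigE r) //; first last.
- move=> y _; apply: contraNeq => /fgP[j [j' [yE xE']]].
  apply/mapP; exists j => //; rewrite mem_iota add0n /= ltnS.
  move: xE'; rewrite xE => /Einj /eqP; rewrite eqr_nat => /eqP ->.
  exact: leq_addr.
- rewrite map_inj_uniq ?iota_uniq // => i j /Einj /(addIr _) /eqP.
  by rewrite eqr_nat eqn_add2r => /eqP.
rewrite big_map (eq_bigl xpredT); last by move=> j; rewrite in_setT.
rewrite (_ : x == 0 = (n == 0)); last first.
  by rewrite xE /E mulf_eq0 invr_eq0 (negPf nN) orbF pnatr_eq0.
rewrite -cP -(big_mkord xpredT (fun j => b j * c (n - j)%N)) /index_iota subn0.
apply: eq_big_seq => j; rewrite mem_iota add0n ltnS => /= jn.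
rewrite -gE /b; congr (_ * gf _).
by rewrite xE /E natrB // natrD; field.
Qed.

Definition puiseux_invr (f : puiseux k) : puiseux k :=
  if pselect (f != 0) is left f0 then projT1 (cid (puiseux_inv f0)) else 0.

Fact puiseux_mulVf f : f != 0 -> puiseux_invr f * f = 1.
Proof. by rewrite /puiseux_invr; case: pselect => // f0 _; case: cid. Qed.

Fact puiseux_invr0 : puiseux_invr 0 = 0.
Proof. by rewrite /puiseux_invr; case: pselect => // f0; exfalso; move/eqP: f0; apply. Qed.

HB.instance Definition _ := GRing.ComNzRing_isField.Build (puiseux k)
  puiseux_mulVf puiseux_invr0.

End PuiseuxField.

Section Ideals.
Context (A : comNzRingType).
Implicit Types I J P Q : set A.

Definition ideal I : Prop :=
  I 0 /\ forall a u v, I u -> I v -> I (a * u + v).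

Definition prime_ideal P : Prop :=
  [/\ ideal P, ~ P 1 & forall u v, P (u * v) -> P u \/ P v].

Definition radical_ideal I : Prop :=
  ideal I /\ forall u n, I (u ^+ n) -> I u.

Definition minimal_prime I P : Prop :=
  [/\ prime_ideal P, I `<=` P &
    forall Q, prime_ideal Q -> I `<=` Q -> Q `<=` P -> Q = P].

Definition chain (C : set (set A)) (n : nat) : Prop :=
  exists J : nat -> set A,
    (forall i, (i <= n)%N -> C (J i)) /\ (forall i, (i < n)%N -> J i `<` J i.+1).

Definition max_chain (C : set (set A)) (n : nat) : Prop :=
  chain C n /\ ~ chain C n.+1.

(* The Krull dimension of the quotient ring A/I is n. *)
Definition krull_dim I (n : nat) : Prop :=
  max_chain [set P | prime_ideal P /\ I `<=` P] n.

(* The localisation (A/I)_P has length n as a module over itself: its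
   submodules correspond, with their inclusions, to the ideals of A that
   contain I and are contracted from the localisation at P. *)
Definition loc_length I P (n : nat) : Prop :=
  max_chain [set J | [/\ ideal J, I `<=` J &
    forall s u, ~ P s -> J (s * u) -> J u]] n.

End Ideals.

(* Closed subvarieties of the torus (K^* )^n are given by radical ideals of the
   ring of Laurent polynomials, so that K need not be algebraically closed (it
   is not for Puiseux series in positive characteristic). An ideal
   generated by polynomials of degree at most 1 is prime or improper. *)
Section Torus.
Context (n : nat) (K : fieldType).
Implicit Types I : set (laurent n K).

Definition linear_poly : set (laurent n K) :=
  [set f | exists (c0 : K) (c : 'rV[K]_n),
    f = mono _ c0 0 + \sum_i mono _ (c 0 i) (delta_mx 0 i)].

Definition plane I : Prop :=
  (exists2 L, L `<=` linear_poly & I = smallest (@ideal _) L) /\ krull_dim I 2.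

Definition curve I : Prop :=
  [/\ radical_ideal I, ~ I 1 & forall P, minimal_prime I P -> krull_dim P 1].

End Torus.

Section Tropicalisation.
Context (R : realType) (k : fieldType) (n : nat).
Implicit Types (c : puiseux k) (f : laurent n (puiseux k)) (w : 'rV[R]_n).
Implicit Types I : set (laurent n (puiseux k)).

(* Only meaningful for c != 0. *)
Definition pval c : rat :=
  xget 0 [set q | c q != 0 /\ forall r, c r != 0 -> q <= r].

Definition plead c : k := c (pval c).

(* Max convention: the tropical absolute value of c is - pval c. *)
Definition trop_term w f (u : 'rV[int]_n) : R :=
  \sum_i (u 0 i)%:~R * w 0 i - ratr (pval (f u)).

Definition trop_max w f : set 'rV[int]_n :=
  [set u | f u != 0 /\
    forall v, f v != 0 -> trop_term w f v <= trop_term w f u].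

Definition trop_hypersurface f : set 'rV[R]_n :=
  [set w | exists u v, [/\ u != v, trop_max w f u & trop_max w f v]].

Definition trop I : set 'rV[R]_n :=
  \bigcap_(f in [set f | I f /\ f != 0]) trop_hypersurface f.

Fact init_form_subproof w f : laurent_supports n
  (supp (fun u => if u \in trop_max w f then plead (f u) else 0)).
Proof.
apply: supp_ok_sub (coefP f) => u; rewrite /supp /=.
by case: ifP => [/set_mem[]|]; rewrite ?eqxx.
Qed.

Definition init_form w f : laurent n k := Series (init_form_subproof w f).

Definition init_ideal w I : set (laurent n k) :=
  smallest (@ideal _) [set init_form w f | f in I].

(* The weight of trop I at a point w in the relative interior of a facet: the
   sum of the multiplicities of the minimal primes of the initial ideal. *)
Definition trop_mult w I (m : nat) : Prop :=
  exists (r : nat) (P : 'I_r -> set (laurent n k)) (l : 'I_r -> nat),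
    [/\ injective P, range P = minimal_prime (init_ideal w I),
      forall i, loc_length (init_ideal w I) (P i) (l i) & m = (\sum_i l i)%N].

(* A weighted fan is the list of its facets, each given by the generators of a
   simplicial cone and a weight. *)
Definition wfan : Type := seq (seq 'rV[int]_n * nat).

Definition conic (vs : seq 'rV[int]_n) (a : 'I_(size vs) -> R) : 'rV[R]_n :=
  \sum_i a i *: map_mx intr vs`_i.

Definition cone (vs : seq 'rV[int]_n) : set 'rV[R]_n :=
  [set x | exists2 a, (forall i, 0 <= a i) & x = @conic vs a].

Definition relint_cone (vs : seq 'rV[int]_n) : set 'rV[R]_n :=
  [set x | exists2 a, (forall i, 0 < a i) & x = @conic vs a].

Definition fan_supp (X : wfan) : set 'rV[R]_n :=
  [set x | exists2 s, s \in X & cone s.1 x].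

Definition tropicalises_to I (X : wfan) : Prop :=
  trop I = fan_supp X /\
  forall s, s \in X -> forall w, relint_cone s.1 w -> trop_mult w I s.2.

End Tropicalisation.

Definition vec3 (a b c : int) : 'rV[int]_3 := \row_i [:: a; b; c]`_i.

Definition std_plane : wfan 3 :=
  let e0 := vec3 1 1 1 in let e1 := vec3 (-1) 0 0 in
  let e2 := vec3 0 (-1) 0 in let e3 := vec3 0 0 (-1) in
  [:: ([:: e0; e1], 1%N); ([:: e0; e2], 1%N); ([:: e0; e3], 1%N);
      ([:: e1; e2], 1%N); ([:: e1; e3], 1%N); ([:: e2; e3], 1%N)].

Definition three_rays (d : int) : wfan 3 :=
  [:: ([:: vec3 0 1 1], 1%N); ([:: vec3 (1 - d) (- d) 0], 1%N);
      ([:: vec3 (d - 1) (d - 1) (-1)], 1%N)].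

Definition realisable (R : realType) (k : closedFieldType) (V B : wfan 3) : Prop :=
  exists IV IC : set (laurent 3 (puiseux k)),
    [/\ plane IV, tropicalises_to R IV V,
        curve IC, IV `<=` IC & tropicalises_to R IC B].

(* Main.v *)
(* Let x_1, x_2, x_3 be the coordinates of the torus. Since Trop(V) is the standard
   plane, V has an equation c_0 + c_1 x_1 + c_2 x_2 + c_3 x_3 = 0 whose coefficients
   all have the same valuation. A curve C of tropicalisation B has degree d and two
   points of multiplicity d - 1 on the coordinate lines of the plane; for d >= 3
   the line c_1 x_1 + c_2 x_2 = 0 through them meets C too often. Consider h = x_1 (c_1 x_1 + c_2 x_2) / x_2. On C, it is
   regular at all points at infinity and vanishes at one of them, without being
   identically zero.

   In terms of valuations: every real valuation of an extension of K that is
   finite on the coordinates of a point of C gives a point of Trop(C) = B, and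
   then an equation of V shows that nu(h) >= val(c_0). On the other hand, on the
   second ray h is dominated by its monomial c_1 x_1^2 / x_2, of unbounded
   valuation, so that no nonzero polynomial in h vanishes on C. Hence there is a
   point of C with coordinates in a field E where h is transcendental over K. The
   Gauss valuation with nu(h) = val(c_0) - 1 extends to E, a contradiction. *)
From HB Require Import structures.
Require Import Defs.
From mathcomp Require Import all_boot all_order all_algebra.
From mathcomp Require Import generic_quotient ring_quotient finmap ring lra zify.
From mathcomp Require Import all_classical all_reals.

Set Implicit Arguments.
Unset Strict Implicit.
Unset Printing Implicit Defensive.

Import Order.TTheory GRing.Theory Num.Theory.
Local Open Scope classical_set_scope.
Local Open Scope ring_scope.

(** * Zorn's lemma and lower bounds of finite families *)

(** [Zorn_bigcup] also needs the union of the empty chain, so [set0] is adjoined to [P]; the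
    nonempty [X0] keeps [set0] from being maximal. *)
Lemma Zorn_nonempty (T : Type) (P : set (set T)) (X0 : set T) :
  P X0 -> X0 !=set0 ->
  (forall F : set (set T), F `<=` P -> F !=set0 -> total_on F subset ->
    P (\bigcup_(X in F) X)) ->
  exists A, P A /\ forall B, A `<=` B -> P B -> B = A.
Proof.
move=> PX0 [x0 X0x0] Pchain.
have [|A [PA Amax]] := @Zorn_bigcup T [set X | X = set0 \/ P X].
  move=> F FP Ftot; pose F' := F `&` P.
  have -> : \bigcup_(X in F) X = \bigcup_(X in F') X.
    apply/seteqP; split=> x [X FX Xx]; exists X => //; last by case: FX.
    by split=> //; case: (FP _ FX) Xx => // ->.
  have [->|/set0P F'0] := eqVneq F' set0; first by left; exact: bigcup_set0.
  by right; apply: Pchain => // [X []|X Y [FX _] [FY _]] //; exact: Ftot.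
have PA' : P A.
  case: PA => // A0; case: (Amax X0); last by right.
  by rewrite A0; split=> // /(_ _ X0x0).
exists A; split=> // B AB PB; apply/seteqP; split=> //; apply: contrapT => BA.
by apply: (Amax B); [split|right].
Qed.

Lemma seq_lbound (R : realType) (I : finType) (F : I -> R) :
  exists m, forall i, m <= F i.
Proof.
exists (- \sum_i `|F i|) => i; rewrite (bigD1 i) //= opprD.
have : 0 <= \sum_(j | j != i) `|F j| by apply: sumr_ge0.
by have := ler_norm (- F i); rewrite normrN; lra.
Qed.

(** * Real valuations *)

Section Valuations.
Context (R : realType).

(* The value of a valuation at 0 is junk. *)
Definition val_ge (D : idomainType) (v : D -> R) (a : R) (x : D) : Prop :=
  x != 0 -> a <= v x.

(** The ultrametric inequality is stated by thresholds, so that 0 behaves as if its value were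
    infinite. *)
Record valuation (D : idomainType) (v : D -> R) : Prop := Valuation {
  valM : forall x y, x != 0 -> y != 0 -> v (x * y) = v x + v y;
  val_geD : forall a x y, val_ge v a x -> val_ge v a y -> val_ge v a (x + y) }.

Definition val_gt (D : idomainType) (v : D -> R) (a : R) (x : D) : Prop :=
  x != 0 -> a < v x.

Section Theory.
Context (D : idomainType) (v : D -> R) (vP : valuation v).
Implicit Types (x y : D) (a b : R).

Lemma val1 : v 1 = 0.
Proof.
have := valM vP (oner_neq0 D) (oner_neq0 D); rewrite mulr1 => h; lra.
Qed.

Lemma valN1 : v (- 1) = 0.
Proof.
have n0 : (- 1 : D) != 0 by rewrite oppr_eq0 oner_neq0.
have := valM vP n0 n0; rewrite mulrNN mulr1 val1 => h; lra.
Qed.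

Lemma valN x : x != 0 -> v (- x) = v x.
Proof.
move=> x0; rewrite -mulN1r (valM vP) ?oppr_eq0 ?oner_neq0 //.
by rewrite valN1 add0r.
Qed.

Lemma valX x n : x != 0 -> v (x ^+ n) = n%:R * v x.
Proof.
move=> x0; elim: n => [|n IH]; first by rewrite expr0 val1 mul0r.
by rewrite exprS (valM vP) ?expf_neq0 // IH -natr1; ring.
Qed.

Lemma val_gtD a x y : val_gt v a x -> val_gt v a y -> val_gt v a (x + y).
Proof.
move=> xa ya.
have [->|x0] := eqVneq x 0; first by rewrite add0r.
have [->|y0] := eqVneq y 0; first by rewrite addr0.
move=> xy0; apply: (@lt_le_trans _ _ (Num.min (v x) (v y))).
  by rewrite lt_min xa ?ya.
by apply: (val_geD vP) xy0 => _; rewrite ge_min lexx ?orbT.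
Qed.

Lemma val_gt_sum a (I : Type) (r : seq I) (P : pred I) (F : I -> D) :
  (forall i, P i -> val_gt v a (F i)) -> val_gt v a (\sum_(i <- r | P i) F i).
Proof.
by move=> Fa; elim/big_ind: _ => //; [rewrite /val_gt eqxx|exact: val_gtD].
Qed.

Lemma val_ge_sum a (I : Type) (r : seq I) (P : pred I) (F : I -> D) :
  (forall i, P i -> val_ge v a (F i)) -> val_ge v a (\sum_(i <- r | P i) F i).
Proof.
by move=> Fa; elim/big_ind: _ => //; [rewrite /val_ge eqxx|exact: val_geD].
Qed.

Lemma val_gtN a x : val_gt v a x -> val_gt v a (- x).
Proof. by move=> xa; rewrite /val_gt oppr_eq0 => x0; rewrite valN ?xa. Qed.

(** If [x + y] had a larger value, then [x], the difference of [x + y] and [y], would have a value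
    above [v x]. *)
Lemma val_add_dom x y : x != 0 -> val_gt v (v x) y ->
  x + y != 0 /\ v (x + y) = v x.
Proof.
move=> x0 xy; have xy0 : x + y != 0.
  apply/negP; rewrite addr_eq0 => /eqP xE.
  have y0 : y != 0 by rewrite -oppr_eq0 -xE.
  by have := xy y0; rewrite xE valN // ltxx.
split=> //; apply/le_anti/andP; split; last first.
  by apply: (val_geD vP) xy0 => [_|/xy/ltW].
rewrite leNgt; apply/negP => lt.
have : val_gt v (v x) (x + y + - y) by apply: val_gtD => //; exact: val_gtN.
by rewrite addrK => /(_ x0); rewrite ltxx.
Qed.

(** A single term of least value rules out cancellation; Gauss's lemma and [valuation_trop] both
    rest on this. *)
Lemma val_sum_dom (I : eqType) (r : seq I) (F : I -> D) i : uniq r -> i \in r ->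
  F i != 0 -> (forall j, j \in r -> j != i -> val_gt v (v (F i)) (F j)) ->
  \sum_(j <- r) F j != 0 /\ v (\sum_(j <- r) F j) = v (F i).
Proof.
move=> ur ir Fi Fj; rewrite (bigD1_seq i) //=; apply: val_add_dom => //.
rewrite big_seq_cond; apply: val_gt_sum => j /andP[jr ji]; exact: Fj.
Qed.

End Theory.

Lemma valV (F : fieldType) (v : F -> R) (vP : valuation v) x :
  x != 0 -> v x^-1 = - v x.
Proof.
move=> x0; have := valM vP x0 (invr_neq0 x0); rewrite divff // (val1 vP) => h.
lra.
Qed.

Lemma val_div (F : fieldType) (v : F -> R) (vP : valuation v) x y :
  x != 0 -> y != 0 -> v (x / y) = v x - v y.
Proof. by move=> x0 y0; rewrite (valM vP) ?invr_neq0 // (valV vP). Qed.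

End Valuations.

(** * Maps and valuations on fraction fields *)

Section FractionField.
Context (D : idomainType).

Lemma frac_repr (x : {fraction D}) :
  exists n d : D, d != 0 /\ x = tofrac n / tofrac d.
Proof.
elim/quotW: x => y; exists (\n_y), (\d_y); split; first exact: denom_ratioP.
have d0 := denom_ratioP y.
have d0' : tofrac \d_y != 0 by rewrite tofrac_eq0.
apply: (mulIf d0'); rewrite divfK //; unlock FracField.tofrac.
rewrite -[LHS]FracField.pi_mul; apply/eqmodP => /=.
rewrite FracField.equivfE /FracField.mulf !numden_Ratio ?mulf_neq0 ?oner_neq0 //.
by rewrite !mulr1 mulrC.
Qed.

(** Numerator and denominator are fixed by choice, not reduced; [frac_eq] compares them with any
    other representation by cross-multiplication. *)
Definition frac_num (x : {fraction D}) : D := projT1 (cid (frac_repr x)).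

Fact frac_den_subproof (x : {fraction D}) :
  exists d : D, d != 0 /\ x = tofrac (frac_num x) / tofrac d.
Proof. by rewrite /frac_num; case: cid. Qed.

Definition frac_den (x : {fraction D}) : D := projT1 (cid (frac_den_subproof x)).

Lemma frac_den_neq0 x : frac_den x != 0.
Proof. by rewrite /frac_den; case: cid => d []. Qed.

Lemma frac_numden x : x = tofrac (frac_num x) / tofrac (frac_den x).
Proof. by rewrite /frac_den; case: cid => d []. Qed.

Lemma frac_eq (x : {fraction D}) (a b : D) : b != 0 -> x = tofrac a / tofrac b ->
  frac_num x * b = a * frac_den x.
Proof.
move=> b0 xE; apply/eqP; rewrite -(tofrac_eq (frac_num x * b)) !tofracM.
have b0' : tofrac b != 0 by rewrite tofrac_eq0.
have d0' : tofrac (frac_den x) != 0 by rewrite tofrac_eq0 frac_den_neq0.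
by rewrite -eqr_div // -frac_numden -xE.
Qed.

Section Lift.
Context (E : fieldType) (phi : {rmorphism D -> E}).
Hypothesis phi_inj : forall a, a != 0 -> phi a != 0.

Definition frac_lift (x : {fraction D}) : E := phi (frac_num x) / phi (frac_den x).

Lemma frac_liftE a b : b != 0 -> frac_lift (tofrac a / tofrac b) = phi a / phi b.
Proof.
move=> b0; apply/eqP; rewrite /frac_lift eqr_div ?phi_inj ?frac_den_neq0 //.
by rewrite -!rmorphM -(frac_eq b0 erefl).
Qed.

Lemma frac_lift_tofrac a : frac_lift (tofrac a) = phi a.
Proof.
by rewrite -[tofrac a]divr1 -(tofrac1 D) frac_liftE ?oner_neq0 // rmorph1 divr1.
Qed.

Fact frac_lift_is_zmod_morphism : zmod_morphism frac_lift.
Proof.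
move=> x y; rewrite {1}(frac_numden x) {1}(frac_numden y).
have dx := frac_den_neq0 x; have dy := frac_den_neq0 y.
rewrite -mulNr addf_div ?tofrac_eq0 // -tofracN -!tofracM -tofracD.
rewrite frac_liftE ?mulf_neq0 // rmorphD !rmorphM rmorphN.
by rewrite -addf_div ?phi_inj // mulNr.
Qed.

Fact frac_lift_is_monoid_morphism : monoid_morphism frac_lift.
Proof.
split=> [|x y]; first by rewrite -(tofrac1 D) frac_lift_tofrac rmorph1.
rewrite {1}(frac_numden x) {1}(frac_numden y).
have dx := frac_den_neq0 x; have dy := frac_den_neq0 y.
by rewrite mulf_div -!tofracM frac_liftE ?mulf_neq0 // !rmorphM -mulf_div.
Qed.

HB.instance Definition _ := GRing.isZmodMorphism.Build {fraction D} E frac_lift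
  frac_lift_is_zmod_morphism.
HB.instance Definition _ := GRing.isMonoidMorphism.Build {fraction D} E frac_lift
  frac_lift_is_monoid_morphism.

Lemma frac_lift_ex : exists f : {rmorphism {fraction D} -> E},
  forall a, f (tofrac a) = phi a.
Proof. by exists frac_lift; exact: frac_lift_tofrac. Qed.

End Lift.

(** A fraction gets the value of its numerator minus that of its denominator; over a common
    denominator the inequality for sums comes from [D]. *)
Lemma frac_valuation (R : realType) (v : D -> R) : valuation v ->
  exists2 v' : {fraction D} -> R, valuation v' &
    forall a, a != 0 -> v' (tofrac a) = v a.
Proof.
move=> vP; pose v' x := v (frac_num x) - v (frac_den x).
have v'E a b : a != 0 -> b != 0 -> v' (tofrac a / tofrac b) = v a - v b.
  move=> a0 b0; have := frac_eq b0 (erefl (tofrac a / tofrac b)).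
  set x := _ / _ => E; have dx := frac_den_neq0 x.
  have nx : frac_num x != 0.
    apply: contra_neq (mulf_neq0 a0 dx) => n0.
    by rewrite -E n0 mul0r.
  by have := congr1 v E; rewrite !(valM vP) // /v' => ?; lra.
have num_neq0 x : x != 0 -> frac_num x != 0.
  by apply: contra_neq => n0; rewrite (frac_numden x) n0 tofrac0 mul0r.
have den0 := frac_den_neq0.
exists v'; last first.
  move=> a a0; rewrite -[tofrac a]divr1 -(tofrac1 D) v'E ?oner_neq0 //.
  by rewrite (val1 vP) subr0.
split=> [x y /num_neq0 x0 /num_neq0 y0|a x y xa ya].
  rewrite {1}(frac_numden x) {1}(frac_numden y) mulf_div -!tofracM.
  by rewrite v'E ?mulf_neq0 // !(valM vP) // /v'; ring.
move=> xy0; have dx := den0 x; have dy := den0 y.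
have xyE : x + y = tofrac (frac_num x * frac_den y + frac_num y * frac_den x) /
    tofrac (frac_den x * frac_den y).
  rewrite tofracD !tofracM -addf_div ?tofrac_eq0 //.
  by rewrite -!frac_numden.
rewrite xyE v'E ?mulf_neq0 //; last first.
  by apply: contra_neq xy0 => n0; rewrite xyE n0 tofrac0 mul0r.
rewrite lerBrDr; apply: (val_geD vP).
- move=> nn; have nx : frac_num x != 0 by apply: contraNneq nn => ->; rewrite mul0r.
  rewrite !(valM vP) //; have : a <= v' x.
    by apply: xa; rewrite (frac_numden x) mulf_neq0 ?invr_eq0 ?tofrac_eq0.
  by rewrite /v'; lra.
- move=> nn; have ny : frac_num y != 0 by apply: contraNneq nn => ->; rewrite mul0r.
  rewrite !(valM vP) //; have : a <= v' y.
    by apply: ya; rewrite (frac_numden y) mulf_neq0 ?invr_eq0 ?tofrac_eq0.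
  by rewrite /v'; lra.
- apply: contra_neq xy0 => n0.
  by rewrite xyE n0 tofrac0 mul0r.
Qed.

End FractionField.

(** * Gauss valuations on polynomials *)

Section Gauss.
Context (R : realType) (D : idomainType) (v : D -> R) (vP : valuation v) (q : R).
Implicit Types p : {poly D}.

Local Notation wt p i := (v p`_i + i%:R * q).

(** Taking the least index of minimal weight singles out one dominant term in a coefficient of a
    product. *)
Definition gauss_index p (i : nat) : Prop :=
  [/\ p`_i != 0, forall j, p`_j != 0 -> wt p i <= wt p j &
      forall j, (j < i)%N -> p`_j != 0 -> wt p i < wt p j].

Lemma gauss_index_ex p : p != 0 -> exists i, gauss_index p i.
Proof.
move=> p0; pose minim i := p`_i != 0 /\ forall j, p`_j != 0 -> wt p i <= wt p j.
have : exists i, `[< minim i >].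
  have lt : ((size p).-1 < size p)%N by rewrite prednK // size_poly_gt0.
  have nz : p`_(Ordinal lt) != 0 by rewrite -lead_coefE lead_coef_eq0.
  case: (@arg_minP _ _ _ (Ordinal lt) (fun i : 'I_(size p) => p`_i != 0)
          (fun i => wt p i) nz) => i pi mi.
  exists i; apply/asboolP; split=> // j pj.
  have jlt : (j < size p)%N by rewrite ltnNge; apply: contra pj => /(nth_default 0) ->.
  exact: (mi (Ordinal jlt)).
case/ex_minnP => i /asboolP[pi mi] imin; exists i; split=> // j ji pj.
rewrite lt_neqAle mi // andbT; apply/eqP => wij.
suff : `[< minim j >] by move=> /imin; rewrite leqNgt ji.
by apply/asboolP; split=> // l /mi; rewrite wij.
Qed.

(** The value of a polynomial is its minimal weight; multiplicativity is Gauss's lemma. *)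
Lemma gauss_valuation : exists w : {poly D} -> R,
  [/\ valuation w, forall c, c != 0 -> w c%:P = v c & w 'X = q].
Proof.
have /choice[idx idxP] : forall p, exists i, p != 0 -> gauss_index p i.
  move=> p; have [->|/gauss_index_ex[i]] := eqVneq p 0; last by exists i.
  by exists 0%N => /eqP.
pose w p := wt p (idx p).
have wP p i : p != 0 -> gauss_index p i -> w p = wt p i.
  move=> p0 [pi mi _]; have [pj mj _] := idxP _ p0.
  by apply/le_anti/andP; split; [exact: mj|exact: mi].
exists w; split; last 2 first.
- move=> c c0; rewrite (wP _ 0%N) ?polyC_eq0 //; first by rewrite coefC eqxx mul0r addr0.
  split=> [|j|j]; rewrite !coefC ?eqxx //=.
  by have [->|_] := eqVneq j 0%N; rewrite ?eqxx.
- rewrite (wP _ 1%N) ?polyX_eq0 ?coefX //=; first by rewrite (val1 vP) add0r mul1r.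
  split=> [|j|j]; rewrite !coefX ?oner_neq0 //=.
    by have [->|_] := eqVneq j 1%N; rewrite ?eqxx.
  by have [->|_] := eqVneq j 1%N; rewrite ?eqxx ?ltnn.
split=> [x y x0 y0|a x y xa ya]; last first.
  move=> xy0; have [xyi _ _] := idxP _ xy0.
  rewrite -lerBlDr; move: xyi; rewrite coefD; apply: (val_geD vP) => z0.
    rewrite lerBlDr; have x0 : x != 0 by apply: contra_neq z0 => ->; rewrite coef0.
    by have [_ m _] := idxP _ x0; apply: le_trans (m _ z0); exact: xa.
  rewrite lerBlDr; have y0 : y != 0 by apply: contra_neq z0 => ->; rewrite coef0.
  by have [_ m _] := idxP _ y0; apply: le_trans (m _ z0); exact: ya.
have [xi mx lx] := idxP _ x0; have [yj my ly] := idxP _ y0.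
set i := idx x in xi mx lx *; set j := idx y in yj my ly *.
have xy0 := mulf_neq0 x0 y0; have [xyk mk _] := idxP _ xy0.
(* In the coefficient at [i + j], every other nonzero product takes a coefficient of [x] below [i]
   or one of [y] below [j], hence has larger value. *)
have [nz vE] : (x * y)`_(i + j) != 0 /\ v (x * y)`_(i + j) = v x`_i + v y`_j.
  have lt : (i < (i + j).+1)%N by rewrite ltnS leq_addr.
  have E : y`_(i + j - i) = y`_j by rewrite addKn.
  rewrite coefM -(valM vP) // -E; apply: (val_sum_dom vP (i := Ordinal lt)) => //.
  - exact: index_enum_uniq.
  - exact: mem_index_enum.
  - by rewrite /= E mulf_neq0.
  move=> l _ /eqP li; rewrite /= E => nz.
  have xl : x`_l != 0 by apply: contraNneq nz => ->; rewrite mul0r.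
  have yl : y`_(i + j - l) != 0 by apply: contraNneq nz => ->; rewrite mulr0.
  have lij : (l <= i + j)%N by rewrite -ltnS.
  have hx := mx _ xl; have hy := my _ yl; rewrite !(valM vP) //.
  have sum : (i + j - l)%:R + l%:R = i%:R + j%:R :> R by rewrite -!natrD subnK.
  have sumq : (i + j - l)%:R * q + l%:R * q = i%:R * q + j%:R * q by rewrite -!mulrDl sum.
  have [lti|gti|eqi] := ltngtP l i.
  - have := lx _ lti xl; lra.
  - have ltj : (i + j - l < j)%N by clear -gti lij; lia.
    have := ly _ ltj yl; lra.
  - by case: li; apply: val_inj.
(* Each nonzero product occurring in a coefficient of [x * y] weighs at least as much as the two
   minima together; the coefficient at [i + j] gives the reverse bound. *)
have le1 : wt x i + wt y j <= wt (x * y) (idx (x * y)).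
  rewrite -lerBlDr; move: xyk; rewrite coefM; apply: (val_ge_sum vP) => l _ nzl.
  have xl : x`_l != 0 by apply: contraNneq nzl => ->; rewrite mul0r.
  have yl : y`_(idx (x * y) - l) != 0 by apply: contraNneq nzl => ->; rewrite mulr0.
  have hx := mx _ xl; have hy := my _ yl; rewrite !(valM vP) //.
  have lij : (l <= idx (x * y)%R)%N by rewrite -ltnS.
  have sum : (idx (x * y)%R - l)%:R + l%:R = (idx (x * y)%R)%:R :> R.
    by rewrite -!natrD subnK.
  by have := congr1 (fun z => z * q) sum; rewrite mulrDl; lra.
apply/le_anti/andP; split=> //.
have := mk _ nz; rewrite vE natrD mulrDl /w; lra.
Qed.

End Gauss.

(** * Extension of a real valuation to an algebraic extension *)

Section AlgebraicExtension.
Context (R : realType) (F E : fieldType) (f : {rmorphism F -> E}).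
Context (v : F -> R) (vP : valuation v).
Hypothesis v_dense : forall a b : R, a < b -> exists2 c, c != 0 & a < v c < b.

Definition subring (A : pzRingType) (O : set A) : Prop :=
  [/\ O 1, forall x y, O x -> O y -> O (x - y) & forall x y, O x -> O y -> O (x * y)].

(** Only the trace on [F] is prescribed; a maximal subring of this kind turns out to be a valuation
    ring, by [maximal_above_total]. *)
Definition above (O : set E) : Prop :=
  subring O /\ forall c, O (f c) <-> val_ge v 0 c.

Lemma maximal_above : exists O : set E, above O /\
  forall O', O `<=` O' -> above O' -> O' = O.
Proof.
(* The smallest candidate is the image of the valuation ring of [v]. *)
pose V0 := [set x | exists2 c, val_ge v 0 c & x = f c].
apply: (@Zorn_nonempty _ _ V0).
- split; last first.
    by move=> c; split=> [[c' vc' /fmorph_inj ->]//|vc]; exists c.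
  split.
  + by exists 1; rewrite ?rmorph1 // => _; rewrite (val1 vP).
  + move=> _ _ [c vc ->] [c' vc' ->]; exists (c - c'); rewrite ?rmorphB //.
    apply: (val_geD vP) => //; rewrite /val_ge oppr_eq0 => c0.
    by rewrite (valN vP) // vc'.
  + move=> _ _ [c vc ->] [c' vc' ->]; exists (c * c'); rewrite ?rmorphM //.
    rewrite /val_ge mulf_eq0 negb_or => /andP[c0 c0'].
    by rewrite (valM vP) // addr_ge0 ?vc ?vc'.
- by exists 1, 1; rewrite ?rmorph1 // => _; rewrite (val1 vP).
move=> C CP [O0 CO0] Ctot.
have common x y : (\bigcup_(X in C) X) x -> (\bigcup_(X in C) X) y ->
    exists O, [/\ C O, O x & O y].
  move=> [O CO Ox] [O' CO' Oy]; have [OO'|O'O] := Ctot _ _ CO CO'.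
    by exists O'; split=> //; exact: OO'.
  by exists O; split=> //; exact: O'O.
split; last first.
  move=> c; split=> [[O CO /(CP _ CO).2]//|vc].
  by exists O0 => //; apply/(CP _ CO0).2.
split.
- by exists O0 => //; case: (CP _ CO0) => -[].
- move=> x y xC yC; have [O [CO Ox Oy]] := common _ _ xC yC.
  by exists O => //; case: (CP _ CO) => -[_ + _] _; apply.
- move=> x y xC yC; have [O [CO Ox Oy]] := common _ _ xC yC.
  by exists O => //; case: (CP _ CO) => -[_ _ +] _; apply.
Qed.

(* The ideal of O generated by the f c with v c > 0: as v has rank one, a single
   generator is enough for each element. *)
Definition small (O : set E) (x : E) : Prop :=
  exists c, [/\ c != 0, 0 < v c & O (x / f c)].

Section Above.
Context (O : set E) (OP : above O).

Let O1 : O 1. Proof. by case: OP => -[]. Qed.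
Let OB x y : O x -> O y -> O (x - y). Proof. by case: OP => -[_ + _] _; exact. Qed.
Let OM x y : O x -> O y -> O (x * y). Proof. by case: OP => -[_ _ +] _; exact. Qed.
Let O0 : O 0. Proof. by rewrite -(subrr 1); exact: OB. Qed.
Let ON x : O x -> O (- x). Proof. by rewrite -sub0r; exact: OB. Qed.
Let OD x y : O x -> O y -> O (x + y).
Proof. by move=> Ox Oy; rewrite -[y]opprK; exact/OB/ON. Qed.
Let Of c : O (f c) <-> val_ge v 0 c. Proof. by case: OP. Qed.

Lemma small1 : ~ small O 1.
Proof.
move=> [c [c0 vc]]; rewrite div1r -fmorphV => /Of/(_ (invr_neq0 c0)).
rewrite (valV vP) //; lra.
Qed.

Lemma smallM a x : O a -> small O x -> small O (a * x).
Proof. by move=> Oa [c [c0 vc Ox]]; exists c; split=> //; rewrite -mulrA; exact: OM. Qed.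

Lemma small0 : small O 0.
Proof. by have [c c0 /andP[vc _]] := v_dense ltr01; exists c; split; rewrite ?mul0r. Qed.

Lemma smallD x y : small O x -> small O y -> small O (x + y).
Proof.
(* The constant of smaller value divides the other up to an element of [O], so it serves for the
   sum. *)
wlog : x y / exists c c', [/\ c != 0, c' != 0, O (x / f c), O (y / f c') & 0 < v c <= v c'].
  move=> H [c [c0 vc Ox]] [c' [c0' vc' Oy]]; have [le|/ltW le] := leP (v c) (v c').
    by apply: H; [exists c, c'; rewrite vc|exists c|exists c'].
  by rewrite addrC; apply: H; [exists c', c; rewrite vc'|exists c'|exists c].
move=> [c [c' [c0 c0' Ox Oy /andP[vc le]]]] _ _; exists c; split=> //.
rewrite mulrDl; apply: OD => //.
rewrite -[y](divfK (_ : f c' != 0)) ?fmorph_eq0 // -[X in O X]mulrA; apply: OM => //.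
by rewrite -fmorph_div; apply/Of => _; rewrite (val_div vP) // subr_ge0.
Qed.

(* Multiplying the first relation by 1 - b, b the constant term of the second,
   and substituting the second relation for its leading term lowers its degree. *)
Lemma small_horner_inv x (p q : {poly E}) : x != 0 ->
  (forall i, small O p`_i) -> (forall i, small O q`_i) ->
  p.[x] = 1 -> q.[x^-1] = 1 -> False.
Proof.
have [n] := ubnP (size p + size q).
elim: n x p q => // n IH x p q szn x0 pS qS px qx.
(* Replacing [x] by its inverse exchanges the two relations. *)
wlog le : x p q szn x0 pS qS px qx / (size q <= size p)%N.
  move=> H; have [|/ltnW le] := leqP (size q) (size p); first exact: (H x p q).
  by apply: (H x^-1 q p); rewrite ?invrK ?invr_eq0 // addnC.
have [sq|sq] := leqP (size q) 1.
  by apply: small1; rewrite -qx [q](size1_polyC sq) hornerC.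
have [m szp] : exists m, size p = m.+2 by exists (size p).-2; lia.
have [l szq] : exists l, size q = l.+2 by exists (size q).-2; lia.
have lm : (l <= m)%N by lia.
have Osmall y : small O y -> O y.
  move=> [c [c0 vc Oy]]; rewrite -[y](divfK (_ : f c != 0)) ?fmorph_eq0 //.
  by apply: OM => //; apply/Of => _; exact: ltW.
(* With b the constant term of [q], the first summand is 1 - b times [p] without its leading term,
   and the second rewrites 1 - b times the leading term at [x] in lower powers. Thus [r] takes the
   value 1 - b at [x], and adding b gives 1 again. *)
pose r := \poly_(i < m.+1) ((1 - q`_0) * p`_i
  + (if (m - l <= i)%N then p`_m.+1 * q`_(m.+1 - i) else 0)).
pose r' := r + (q`_0)%:P.
apply: (IH x r' q) => //.
- have : (size r' <= m.+1)%N.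
    rewrite (leq_trans (size_polyD _ _)) // geq_max size_poly /=.
    by rewrite (leq_trans (size_polyC_leq1 _)).
  by move=> /leq_add/(_ (leqnn (size q)))/leq_ltn_trans; apply; rewrite szp in szn.
- move=> i; rewrite coefD coefC coef_poly; apply: smallD; last first.
    by case: (i == 0%N) => //; exact: small0.
  case: ifP => _; last exact: small0.
  apply: smallD; first by apply: smallM => //; apply: OB => //; exact: Osmall.
  case: ifP => _; last exact: small0.
  by apply: smallM => //; exact: Osmall.
(* This is the relation of [q] at the inverse of [x], multiplied by [x ^+ m.+1]. *)
have qE : x ^+ m.+1 * (1 - q`_0) = \sum_(j < l.+1) q`_j.+1 * x ^+ (m - j).
  rewrite -{1}qx [in LHS]horner_coef szq big_ord_recl /= expr0 mulr1.
  rewrite [q`_0 + _]addrC addrK mulr_sumr; apply: eq_bigr => j _.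
  have jm : (j < m.+1)%N by rewrite (leq_trans (ltn_ord j)) // ltnS.
  rewrite mulrCA -[in x ^+ m.+1](subnK jm) subSS exprD exprVn mulfK //.
  by rewrite expf_neq0.
rewrite hornerD hornerC horner_poly.
under eq_bigr do rewrite mulrDl -mulrA.
rewrite big_split /= -mulr_sumr.
have -> : \sum_(i < m.+1) (if (m - l <= i)%N then p`_m.+1 * q`_(m.+1 - i) else 0) * x ^+ i
    = p`_m.+1 * (x ^+ m.+1 * (1 - q`_0)).
  rewrite qE mulr_sumr (reindex_inj rev_ord_inj) /=.
  rewrite (big_ord_widen m.+1 (fun j => p`_m.+1 * (q`_j.+1 * x ^+ (m - j)))) ?ltnS //.
  rewrite [RHS]big_mkcond /=; apply: eq_bigr => j _.
  have jm : (j <= m)%N by rewrite -ltnS.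
  rewrite subSS (_ : (m - l <= m - j)%N = (j < l.+1)%N); last by lia.
  rewrite (_ : (m.+1 - (m - j))%N = j.+1); last by lia.
  by case: ifP => _; rewrite ?mul0r ?mulrA.
rewrite [p`_m.+1 * _]mulrA [_ * (1 - _)]mulrC -mulrDr.
move: px; rewrite horner_coef szp big_ord_recr /= => ->.
by rewrite mulr1 subrK.
Qed.

Hypothesis Omax : forall O', O `<=` O' -> above O' -> O' = O.

Let Osum (I : Type) (r : seq I) (G : I -> E) :
  (forall i, O (G i)) -> O (\sum_(i <- r) G i).
Proof. by move=> OG; elim/big_ind: _. Qed.
Let OX x n : O x -> O (x ^+ n).
Proof. by move=> Ox; elim: n => [|n IH]; rewrite ?expr0 // exprS; exact: OM. Qed.

(** By maximality the ring generated by [O] and [x] contains some [f c] with [v c < 0]. Dividing its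
    expression as a polynomial in [x] by [f c] gives 1 with small coefficients. *)
Lemma notin_small_horner x : ~ O x ->
  exists p : {poly E}, (forall i, small O p`_i) /\ p.[x] = 1.
Proof.
move=> nOx; pose O' := [set y | exists2 p : {poly E}, (forall i, O p`_i) & y = p.[x]].
have OO' : O `<=` O'.
  move=> y Oy; exists y%:P; last by rewrite hornerC.
  by move=> i; rewrite coefC; case: ifP.
have subO' : subring O'.
  split; first exact: OO'.
    move=> _ _ [p pO ->] [q qO ->]; exists (p - q); last by rewrite hornerD hornerN.
    by move=> i; rewrite coefB; exact: OB.
  move=> _ _ [p pO ->] [q qO ->]; exists (p * q); last by rewrite hornerM.
  by move=> i; rewrite coefM; apply: Osum => j; exact: OM.
have [c O'c vc] : exists2 c, O' (f c) & ~ val_ge v 0 c.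
  apply: contrapT => H; apply: nOx; rewrite -(Omax OO').
    exists 'X; last by rewrite hornerX.
    by move=> i; rewrite coefX; case: (i == 1%N).
  split=> // c; split=> [O'c|/Of/OO' //].
  by apply: contrapT => vc; apply: H; exists c.
have {vc}[c0 vc] : c != 0 /\ v c < 0.
  by have /asboolPn := vc; rewrite asbool_imply negb_imply !asboolb -ltNge => /andP[].
case: O'c => p pO cE; exists ((f c)^-1 *: p); split; last first.
  by rewrite hornerZ -cE mulVf ?fmorph_eq0.
move=> i; rewrite coefZ; exists c^-1; split; first by rewrite invr_eq0.
  by rewrite (valV vP) // oppr_gt0.
by rewrite fmorphV invrK mulrC mulrA divff ?mul1r ?fmorph_eq0.
Qed.

(** If [x] and its inverse were both outside [O], each would satisfy a relation with small
    coefficients, which [small_horner_inv] excludes. *)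
Lemma maximal_above_total x : x != 0 -> O x \/ O x^-1.
Proof.
move=> x0; apply: contrapT => /not_orP[nx nx'].
have [p [pS px]] := notin_small_horner nx.
have [q [qS qx]] := notin_small_horner nx'.
exact: small_horner_inv x0 pS qS px qx.
Qed.

(** When [x] is not in [O], its inverse is. The algebraic equation, divided by its leading
    coefficient and a power of [x], writes [x] as a polynomial in the inverse with coefficients from
    [F]; [c] is taken of value below theirs. *)
Lemma algebraic_bounded x : algebraicOver f x ->
  exists2 c, c != 0 & O (x / f c).
Proof.
have [Ox _|nOx] := pselect (O x).
  by exists 1; rewrite ?oner_neq0 // rmorph1 divr1.
have x0 : x != 0 by apply: contra_not_neq nOx => ->.
have [//|Ox'] := maximal_above_total x0.
move=> [p p0 /rootP]; rewrite horner_coef size_map_poly.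
have sp : (0 < size p)%N by rewrite size_poly_gt0.
have : lead_coef p != 0 by rewrite lead_coef_eq0.
rewrite lead_coefE; case: (size p) sp => // -[|n] _ /= pn0.
  rewrite big_ord_recr big_ord0 /= add0r coef_map mulr1 => /eqP.
  by rewrite fmorph_eq0 (negPf pn0).
rewrite big_ord_recr /= coef_map /= => /eqP; rewrite addr_eq0 => /eqP pE.
have [m mP] := @seq_lbound R _ (fun i : 'I_n.+1 => v (p`_i / p`_n.+1)).
have [|c c0 /andP[_ cm]] := @v_dense (m - 1) m; first lra.
have fp0 : f p`_n.+1 != 0 by rewrite fmorph_eq0.
exists c => //.
have -> : x / f c = - \sum_(i < n.+1) f (p`_i / p`_n.+1 / c) * x^-1 ^+ (n - i).
  transitivity (- (x^-1 ^+ n / f p`_n.+1 / f c * - (f p`_n.+1 * x ^+ n.+1))).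
    rewrite mulrN opprK exprS exprVn; field.
    by rewrite fp0 fmorph_eq0 c0 expf_neq0.
  rewrite -pE mulr_sumr; congr (- _); apply: eq_bigr => i _.
  have ni : (i <= n)%N by rewrite -ltnS.
  rewrite coef_map /= !fmorph_div -{1}(subnK ni) exprD [x^-1 ^+ i]exprVn; field.
  by rewrite fp0 fmorph_eq0 c0 expf_neq0.
apply/ON/Osum => i; apply: OM; last exact: OX.
apply/Of => pi0; rewrite (val_div vP) //; last first.
  by apply: contra_neq pi0 => ->; rewrite mul0r.
by rewrite subr_ge0 (le_trans (ltW cm)).
Qed.

End Above.

(** The value of [x] is the supremum of the [v c] with [x / f c] in [O]. Closure of [O] under
    products makes it superadditive, and [O] being a valuation ring gives the reverse inequality. *)
Theorem algebraic_valuation : (forall x : E, algebraicOver f x) ->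
  exists2 w : E -> R, valuation w & forall c, c != 0 -> w (f c) = v c.
Proof.
move=> Ealg; have [O [OP Omax]] := maximal_above.
have [[O1 OB OM] Of] := OP.
have total := maximal_above_total OP Omax.
have fneq0 c : c != 0 -> f c != 0 by rewrite fmorph_eq0.
pose below x := [set v c | c in [set c | c != 0 /\ O (x / f c)]].
have belowM x y a b : x != 0 -> y != 0 -> below x a -> below y b -> below (x * y) (a + b).
  move=> x0 y0 [c [c0 xc] <-] [c' [c0' yc] <-]; exists (c * c'); last exact: valM.
  by split; rewrite /= ?mulf_neq0 // rmorphM -mulf_div; exact: OM.
have below1 a : below 1 a -> a <= 0.
  move=> [c [c0]]; rewrite div1r -fmorphV => /Of/(_ (invr_neq0 c0)).
  by rewrite (valV vP) // oppr_ge0 => + <-.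
have below_neq0 x : below x !=set0.
  by have [c c0 Oc] := algebraic_bounded OP Omax (Ealg x); exists (v c), c.
(* An element of [below] at the inverse provides the upper bound, since [below 1] has no positive
   element. *)
have below_sup x : x != 0 -> has_sup (below x).
  move=> x0; split=> //; have [a xa] := below_neq0 x^-1.
  exists (- a) => b xb; have := belowM _ _ _ _ x0 (invr_neq0 x0) xb xa.
  by rewrite divff // => /below1; lra.
pose w x := sup (below x).
have w_ge x c : x != 0 -> c != 0 -> O (x / f c) -> v c <= w x.
  by move=> x0 c0 xc; apply: sup_upper_bound; [exact: below_sup|exists c].
have lt_w x c : x != 0 -> c != 0 -> v c < w x -> O (x / f c).
  move=> x0 c0; rewrite -subr_gt0 => /sup_adherent/(_ (below_sup _ x0))[_ [c' [c0' xc'] <-]].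
  rewrite subKr => vcc'; rewrite -(divfK (fneq0 _ c0') x) -[X in O X]mulrA.
  apply: OM => //; rewrite -fmorph_div; apply/Of => _.
  by rewrite (val_div vP) // subr_ge0 ltW.
have wM_ge x y : x != 0 -> y != 0 -> w x + w y <= w (x * y).
  move=> x0 y0; rewrite -sup_sumE; [|exact: below_sup..].
  apply: ge_sup; first by have [a xa] := below_neq0 x; have [b yb] := below_neq0 y;
    exists (a + b), a => //; exists b.
  move=> _ [a xa [b yb <-]]; apply: sup_upper_bound; first exact/below_sup/mulf_neq0.
  exact: belowM.
(* Otherwise some constant [c] has its value strictly between [w x] and the opposite of [w x^-1],
   and then neither [x / f c] nor its inverse can lie in [O]. *)
have wV_le x : x != 0 -> - w x <= w x^-1.
  move=> x0; rewrite leNgt; apply/negP => lt; have x0' := invr_neq0 x0.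
  have [|c c0 /andP[xc cx]] := @v_dense (w x) (- w x^-1); first lra.
  have [xO|xO] := total _ (mulf_neq0 x0 (invr_neq0 (fneq0 _ c0))).
    by have := w_ge _ _ x0 c0 xO; lra.
  have := w_ge x^-1 c^-1 x0' (invr_neq0 c0); rewrite fmorphV -invfM => /(_ xO).
  by rewrite (valV vP) //; lra.
have wM x y : x != 0 -> y != 0 -> w (x * y) = w x + w y.
  move=> x0 y0; apply/le_anti/andP; split; last exact: wM_ge.
  have := wM_ge _ _ (mulf_neq0 x0 y0) (invr_neq0 y0); rewrite mulfK //.
  by have := wV_le _ y0; lra.
exists w => [|c c0]; last first.
  apply/le_anti/andP; split; last by apply: w_ge; rewrite ?divff ?fneq0.
  apply: ge_sup => [|_ [c' [c0' +] <-]]; first exact: below_neq0.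
  rewrite -fmorph_div => /Of/(_ (mulf_neq0 c0 (invr_neq0 c0'))).
  by rewrite (val_div vP) // subr_ge0.
split=> // a x y xa ya xy0; rewrite leNgt; apply/negP => lt.
(* Both [x] and [y] become elements of [O] when divided by such an [f c], hence so does their sum,
   against [w (x + y) < v c]. *)
have [c c0 /andP[xyc ca]] := v_dense lt.
have OD u z : O u -> O z -> O (u + z).
  move=> Ou Oz; rewrite -[z]opprK; apply: (OB) => //.
  by rewrite -sub0r -(subrr 1); exact/OB/Oz/OB.
have Oc z : val_ge w a z -> O (z / f c).
  have [-> _|z0 /(_ z0) az] := eqVneq z 0; first by rewrite mul0r -(subrr 1); exact: OB.
  exact/lt_w/(lt_le_trans ca).
have := w_ge _ _ xy0 c0; rewrite mulrDl => /(_ (OD _ _ (Oc _ xa) (Oc _ ya))).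
by rewrite leNgt xyc.
Qed.

End AlgebraicExtension.

(** * Valuations with a prescribed value at a transcendental element *)

(** As [h] is transcendental, sending the variable to [h] embeds the rational functions over [K] in
    [E]; they carry the Gauss valuation with value [q] at the variable. *)
Lemma transcendental_valuation (R : realType) (K E : fieldType)
    (iota : {rmorphism K -> E}) (v : K -> R) (h : E) (q : R) :
  valuation v -> ~ algebraicOver iota h ->
  exists (F : fieldType) (j : {rmorphism K -> F}) (kappa : {rmorphism F -> E})
    (w : F -> R), [/\ valuation w, forall c, kappa (j c) = iota c,
      forall c, c != 0 -> w (j c) = v c &
      exists X, [/\ X != 0, kappa X = h & w X = q]].
Proof.
move=> vP h_tr; have comm : commr_rmorph iota h by move=> x; exact: mulrC.
have inj p : p != 0 -> horner_morph comm p != 0.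
  move=> p0; apply: contra_not_neq h_tr => /eqP ph.
  by exists p => //; exact/rootP/eqP.
have [kappa kappaE] := frac_lift_ex inj.
have [w [wP wC wX]] := gauss_valuation vP q.
have [w' w'P w'E] := frac_valuation wP.
exists {fraction {poly K}}, (@FracField.tofrac {poly K} \o polyC), kappa, w'.
split=> // [c|c c0|] /=.
- by rewrite kappaE /= horner_morphC.
- by rewrite w'E ?polyC_eq0 // wC.
- exists (tofrac 'X); split; first by rewrite tofrac_eq0 polyX_eq0.
    by rewrite kappaE /= horner_morphX.
  by rewrite w'E ?polyX_eq0.
Qed.

(* Any t will do that makes E algebraic over K(h, t), transcendental or not. *)
Lemma two_step_valuation (R : realType) (K E : fieldType)
    (iota : {rmorphism K -> E}) (v : K -> R) (h t : E) (q : R) :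
  valuation v -> (forall a b : R, a < b -> exists2 c, c != 0 & a < v c < b) ->
  ~ algebraicOver iota h ->
  (forall (F : fieldType) (j : {rmorphism K -> F}) (kappa : {rmorphism F -> E}),
    (forall c, kappa (j c) = iota c) -> (exists X, kappa X = h) ->
    algebraicOver kappa t -> forall x, algebraicOver kappa x) ->
  exists2 w : E -> R, valuation w &
    (forall c, c != 0 -> w (iota c) = v c) /\ w h = q.
Proof.
move=> vP v_dense h_tr ht_gen.
have [F [j [kappa [w [wP jE wE [X [X0 XE wX]]]]]]] := transcendental_valuation q vP h_tr.
have w_dense (a b : R) : a < b -> exists2 c, c != 0 & a < w c < b.
  by move=> /v_dense[c c0 ab]; exists (j c); rewrite ?fmorph_eq0 // wE.
have [t_alg|t_tr] := pselect (algebraicOver kappa t).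
  have [|w' w'P w'E] := algebraic_valuation wP w_dense (f := kappa).
    by apply: (ht_gen _ j) => //; exists X.
  exists w' => //; split; last by rewrite -XE w'E.
  by move=> c c0; rewrite -jE w'E ?fmorph_eq0 // wE.
(* A transcendental [t] is adjoined with an arbitrary value, here 0; over the new field [t] is
   algebraic. *)
have [F2 [j2 [kappa2 [w2 [w2P j2E w2E [Y [Y0 YE w2Y]]]]]]] :=
  transcendental_valuation 0 wP t_tr.
have w2_dense (a b : R) : a < b -> exists2 c, c != 0 & a < w2 c < b.
  by move=> /w_dense[c c0 ab]; exists (j2 c); rewrite ?fmorph_eq0 // w2E.
have [|w' w'P w'E] := algebraic_valuation w2P w2_dense (f := kappa2).
  apply: (ht_gen _ (j2 \o j)) => [c /=||]; first by rewrite j2E jE.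
    by exists (j2 X); rewrite j2E.
  by rewrite -YE; exact: algebraic_id.
exists w' => //; split; last by rewrite -XE -j2E w'E ?fmorph_eq0 // w2E.
by move=> c c0; rewrite -jE -j2E w'E ?fmorph_eq0 // w2E ?fmorph_eq0 // wE.
Qed.

(** * Prime ideals avoiding a multiplicative set *)

Section PrimeQuotient.
Context (A : comNzRingType).
Implicit Types (I P S : set A).

(** An ideal maximal among those that contain [I] and avoid [S] is prime. *)
Lemma prime_avoiding I S : ideal I -> S 1 ->
  (forall s s', S s -> S s' -> S (s * s')) -> (forall s, S s -> ~ I s) ->
  exists P, [/\ prime_ideal P, I `<=` P & forall s, S s -> ~ P s].
Proof.
move=> [I0 IP] S1 SM SI.
have [|||P [[[P0 PP] IlP PS] Pmax]] := @Zorn_nonempty A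
    [set J | [/\ ideal J, I `<=` J & forall s, S s -> ~ J s]] I.
- by split.
- by exists 0.
- move=> C CP [J0 CJ0] Ctot; split.
  + split; first by exists J0 => //; have [[]] := CP _ CJ0.
    move=> a u v [J CJ Ju] [J' CJ' Jv].
    have [JJ'|J'J] := Ctot _ _ CJ CJ'.
      by exists J' => //; have [[_ +] _ _] := CP _ CJ'; apply=> //; exact: JJ'.
    by exists J => //; have [[_ +] _ _] := CP _ CJ; apply=> //; exact: J'J.
  + by move=> u Iu; exists J0 => //; have [_ + _] := CP _ CJ0; apply.
  + by move=> s Ss [J CJ Js]; have [_ _ /(_ _ Ss)] := CP _ CJ.
exists P; split=> //; split=> //; first exact: PS.
have PD a b : P a -> P b -> P (a + b).
  by move=> Pa Pb; rewrite -[a]mul1r; exact: PP.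
have PM a b : P b -> P (a * b).
  by move=> Pb; rewrite -[_ * _]addr0; exact: PP.
(* By maximality, the ideal generated by [P] and [u] meets [S]. If [u * v] is in [P], the product of
   two such elements of [S], one for [u] and one for [v], falls into [P]. *)
have meet u : ~ P u -> exists a b, S (a * u + b) /\ P b.
  move=> nPu; apply: contrapT => H; apply: nPu.
  rewrite -(Pmax [set x | exists a b, x = a * u + b /\ P b]).
  - by exists 1, 0; rewrite mul1r addr0.
  - by move=> x Px; exists 0, x; rewrite mul0r add0r.
  split.
  + split; first by exists 0, 0; rewrite mul0r add0r.
    move=> c _ _ [a [b [-> Pb]]] [a' [b' [-> Pb']]].
    by exists (c * a + a'), (c * b + b'); split; [ring|exact: PP].
  + by move=> x Ix; exists 0, x; rewrite mul0r add0r; split=> //; exact: IlP.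
  + by move=> s Ss [a [b [sE Pb]]]; apply: H; exists a, b; rewrite -sE.
move=> u v Puv; apply: contrapT => /not_orP.
move=> [/meet[a [b [Sab Pb]]] /meet[a' [b' [Sab' Pb']]]].
apply: (PS _ (SM _ _ Sab Sab')).
have -> : (a * u + b) * (a' * v + b') =
    (a * a') * (u * v) + ((a' * v + b') * b + (a * u) * b') by ring.
by apply: PP => //; apply: PD; exact: PM.
Qed.

End PrimeQuotient.

(** * The residue field of a prime ideal *)

Section QuotientField.
Local Open Scope quotient_scope.
Context (A : comNzRingType) (P : set A) (PP : prime_ideal P).

Definition prime_pred : pred A := fun x => `[< P x >].

Fact prime_pred_ideal : idealr_closed prime_pred.
Proof.
have [[P0 PD] P1 _] := PP.
split=> [||a u v]; rewrite ?unfold_in; first exact/asboolP.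
  exact/asboolPn.
by move=> /asboolP Pu /asboolP Pv; apply/asboolP; exact: PD.
Qed.

Fact prime_pred_prime : prime_idealr_closed prime_pred.
Proof.
have [_ _ PM] := PP => u v; rewrite !unfold_in => /asboolP/PM[] Pu.
  by apply/orP; left; exact/asboolP.
by apply/orP; right; exact/asboolP.
Qed.

HB.instance Definition _ := isIdealr.Build A prime_pred prime_pred_ideal.
HB.instance Definition _ := isPrimeIdealrClosed.Build A prime_pred prime_pred_prime.

Definition prime_quotient := {ideal_quot (prime_pred : prime_idealr A)}.
HB.instance Definition _ := GRing.ComNzRing.on prime_quotient.

(** Invertibility is decided and inverses are chosen classically; on nonunits the inverse is the
    identity, as the unit ring interface demands. *)
Definition prime_quotient_unit : pred prime_quotient :=
  fun x => `[< exists y, y * x = 1 >].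

Definition prime_quotient_inv (x : prime_quotient) : prime_quotient :=
  if pselect (exists y, y * x = 1) is left xU then projT1 (cid xU) else x.

Fact prime_quotient_mulVx :
  {in prime_quotient_unit, left_inverse 1 prime_quotient_inv *%R}.
Proof.
move=> x /asboolP xU; rewrite /prime_quotient_inv; case: pselect => // xU'.
by case: cid.
Qed.

Fact prime_quotient_unitPl (x y : prime_quotient) :
  y * x = 1 -> prime_quotient_unit x.
Proof. by move=> yx; apply/asboolP; exists y. Qed.

Fact prime_quotient_invr_out :
  {in [predC prime_quotient_unit], prime_quotient_inv =1 id}.
Proof. by move=> x /asboolPn xU; rewrite /prime_quotient_inv; case: pselect. Qed.

HB.instance Definition _ := GRing.ComNzRing_hasMulInverse.Build prime_quotient
  prime_quotient_mulVx prime_quotient_unitPl prime_quotient_invr_out.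

Fact prime_quotient_integral : GRing.integral_domain_axiom prime_quotient.
Proof. by move=> x y; exact: Quotient.rquot_IdomainAxiom. Qed.

HB.instance Definition _ := GRing.ComUnitRing_isIntegral.Build prime_quotient
  prime_quotient_integral.

(** The second clause allows algebraicity of [E] over a subfield to be checked on the image of [A]
    alone. *)
Lemma prime_quotient_field : exists (E : fieldType) (theta : {rmorphism A -> E}),
  (forall u, theta u = 0 <-> P u) /\
  forall x, exists a b, x = theta a / theta b.
Proof.
exists {fraction prime_quotient},
  (@FracField.tofrac prime_quotient \o \pi_prime_quotient); split=> [u|x] /=.
  split=> [/eqP|Pu].
    rewrite tofrac_eq0 -(rmorph0 \pi_prime_quotient) -Quotient.idealrBE subr0.
    by move/asboolP.
  apply/eqP; rewrite tofrac_eq0 -(rmorph0 \pi_prime_quotient) -Quotient.idealrBE.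
  by rewrite subr0; exact/asboolP.
have [n [d [d0 ->]]] := frac_repr x.
by exists (repr n), (repr d); rewrite !reprK.
Qed.

End QuotientField.

(** * Puiseux series and Laurent polynomials *)

Section PuiseuxValuation.
Context (k : fieldType).
Implicit Types c d : puiseux k.

Definition pval_spec c (q : rat) : Prop :=
  c q != 0 /\ forall r, c r != 0 -> q <= r.

(** The common denominator and the lower bound index the exponents by natural numbers, so a nonempty
    support has a least element. *)
Lemma pvalP c : c != 0 -> pval_spec c (pval c).
Proof.
move=> c0; have [N [m [N0 Xm]]] := coefP c.
have nN : (0 : rat) < N%:R by rewrite ltr0n.
pose e (i : nat) : rat := (i%:R - m%:R) / N%:R.
have : exists i, c (e i) != 0.
  apply: contrapT => H; move/eqP: c0; apply; apply: seriesP => q /=.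
  apply: contrapT => /eqP cq; apply: H; have [i qE] := Xm q cq.
  by exists i; rewrite /e -qE.
case/ex_minnP => i ci imin; suff : [set q | pval_spec c q] (pval c) by [].
rewrite /pval; apply: xgetPex.
exists (e i); split=> // r cr; have [j rE] := Xm r cr.
rewrite rE /e ler_pM2r ?invr_gt0 // lerD2r ler_nat; apply: imin.
by rewrite /e -rE.
Qed.

Lemma pval_eq c q : pval_spec c q -> c != 0 /\ pval c = q.
Proof.
move=> [cq mq]; have c0 : c != 0 by apply: contraNneq cq => ->.
split=> //; have [cp mp] := pvalP c0.
by apply/le_anti/andP; split; [exact: mp|exact: mq].
Qed.

Lemma pval_mono (a : k) q : a != 0 -> mono puiseux_supports a q != 0 /\
  pval (mono puiseux_supports a q) = q.
Proof.
move=> a0; apply: pval_eq; split=> [|r] /=; first by rewrite eqxx.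
by have [->//|] := eqVneq r q; rewrite eqxx.
Qed.

Lemma pvalM c d : c != 0 -> d != 0 -> pval (c * d) = pval c + pval d.
Proof.
move=> c0 d0; have [cp mc] := pvalP c0; have [dp md] := pvalP d0.
apply: (pval_eq _).2; split=> [|r].
  (* Only the pair of least exponents contributes to the coefficient at their sum. *)
  rewrite -[(c * d) _]/(conv c d _) (@convE _ _ _ _ _ [fset pval c]%fset).
    by rewrite big_seq_fset1 [pval c + _]addrC addrK mulf_neq0.
  move=> y cy dy; rewrite inE eq_le mc // andbT.
  by have := md _ dy; rewrite -lerBlDr; lra.
move=> /conv_neq0[a ca [b db <-]]; exact: lerD (mc _ ca) (md _ db).
Qed.

Definition rval (R : realType) c : R := ratr (pval c).

Lemma puiseux_valuation (R : realType) : valuation (@rval R).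
Proof.
rewrite /rval; split=> [c d c0 d0|a c d ca da cd0]; first by rewrite pvalM // rmorphD.
have [cdp _] := pvalP cd0; have [cp|cp] := eqVneq (c (pval (c + d))) 0.
  have dp : d (pval (c + d)) != 0 by move: cdp; rewrite Defs.coefD cp add0r.
  have d0 : d != 0 by apply: contraNneq dp => ->.
  by apply: le_trans (da d0) _; rewrite ler_rat; have [_] := pvalP d0; exact.
have c0 : c != 0 by apply: contraNneq cp => ->.
by apply: le_trans (ca c0) _; rewrite ler_rat; have [_] := pvalP c0; exact.
Qed.

(** Monomials with fractional exponents realise every rational value. *)
Lemma pval_dense (R : realType) (a b : R) : a < b ->
  exists2 c : puiseux k, c != 0 & a < rval R c < b.
Proof.
move=> /rat_in_itvoo[q]; rewrite in_itv /= => aqb.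
have [c0 cq] := pval_mono q (oner_neq0 k).
by exists (mono puiseux_supports 1 q) => //; rewrite /rval cq.
Qed.

End PuiseuxValuation.

Section Monomials.
Context (G : zmodType) (S : supports G).

Section Additive.
Context (A : zmodType).

Lemma coef_sum (I : Type) (r : seq I) (P : pred I) (F : I -> series S A) x :
  (\sum_(i <- r | P i) F i) x = \sum_(i <- r | P i) F i x.
Proof. by elim/big_rec2: _ => //= i y z _ <-. Qed.

Lemma monoD (a b : A) u : mono S (a + b) u = mono S a u + mono S b u.
Proof. by apply: seriesP => x /=; case: eqP; rewrite ?addr0. Qed.

Lemma monoN (a : A) u : mono S (- a) u = - mono S a u.
Proof. by apply: seriesP => x /=; case: eqP; rewrite ?oppr0. Qed.

End Additive.

Context (A : comNzRingType).

Lemma monoM (a b : A) u v : mono S a u * mono S b v = mono S (a * b) (u + v).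
Proof.
apply: seriesP => x /=; rewrite (@convE _ _ _ _ _ [fset u]%fset).
  by rewrite big_seq_fset1 /= eqxx subr_eq [v + u]addrC; case: eqP; rewrite ?mulr0.
by move=> y; rewrite inE /=; have [|_] := eqVneq y u; rewrite ?eqxx.
Qed.

Definition const (a : A) : series S A := mono S a 0.

Fact const_is_zmod_morphism : zmod_morphism const.
Proof. by move=> a b; rewrite /const monoD monoN. Qed.

Fact const_is_monoid_morphism : monoid_morphism const.
Proof. by split=> // a b; rewrite /const monoM addr0. Qed.

HB.instance Definition _ := GRing.isZmodMorphism.Build A (series S A) const
  const_is_zmod_morphism.
HB.instance Definition _ := GRing.isMonoidMorphism.Build A (series S A) const
  const_is_monoid_morphism.

Lemma mono_const (a : A) u : mono S a u = const a * mono S 1 u.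
Proof. by rewrite /const monoM mulr1 add0r. Qed.

End Monomials.

Section Laurent.
Context (n : nat) (K : fieldType).
Local Notation L := (laurent_supports n).
Implicit Types (g : laurent n K) (u v : 'rV[int]_n).

Lemma laurent_sum g : exists X : {fset 'rV[int]_n},
  (forall u, (u \in X) = (g u != 0)) /\ g = \sum_(u <- X) mono L (g u) u.
Proof.
have /finite_fsetP[X XE] := coefP g; exists X.
have gX u : (u \in X) = (g u != 0).
  by apply/idP/idP => [uX|gu]; have := congr1 (@^~ u) XE; rewrite /supp /= => H;
     [rewrite H|rewrite -H].
split=> //; apply: seriesP => u; rewrite coef_sum.
have [uX|uX] := boolP (u \in X).
  rewrite (bigD1_seq u) ?fset_uniq //= eqxx big1 ?addr0 // => v.
  by rewrite eq_sym => /negPf ->.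
rewrite big_seq big1; first by move: uX; rewrite gX negbK => /eqP.
by move=> v vX /=; case: eqP uX => // ->; rewrite vX.
Qed.

End Laurent.

Lemma row_additive (n : nat) (R : zmodType) (mu : {additive 'rV[int]_n -> R}) u :
  mu u = \sum_i mu (delta_mx 0 i) *~ u 0 i.
Proof.
rewrite {1}(row_sum_delta u) raddf_sum; apply: eq_bigr => i _.
by rewrite -raddfMz /= -scaler_int intz.
Qed.

(** * From valuations to points of the tropicalisation *)

Section ValuationTrop.
Context (R : realType) (k : fieldType) (n : nat).
Local Notation K := (puiseux k).
Local Notation A := (laurent n K).
Local Notation L := (laurent_supports n).
Context (E : fieldType) (theta : {rmorphism A -> E}).
Context (nu : E -> R) (nuP : valuation nu).
Hypothesis nu_const : forall c : K, c != 0 -> nu (theta (const L c)) = rval R c.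

(** The sign is that of the max convention. *)
Definition val_point : 'rV[R]_n := \row_i - nu (theta (mono L 1 (delta_mx 0 i))).

Lemma theta_mono_neq0 (c : K) u : c != 0 -> theta (mono L c u) != 0.
Proof.
move=> c0; apply/eqP => cu; have /eqP := rmorph1 theta.
have -> : (1 : A) = mono L c^-1 (- u) * mono L c u by rewrite monoM mulVf // addNr.
by rewrite rmorphM cu mulr0 eq_sym oner_eq0.
Qed.

Lemma theta_monoD u u' :
  theta (mono L 1 (u + u')) = theta (mono L 1 u) * theta (mono L 1 u').
Proof. by rewrite -rmorphM monoM mulr1. Qed.

Lemma theta_mono (c : K) u :
  theta (mono L c u) = theta (const L c) * theta (mono L 1 u).
Proof. by rewrite mono_const rmorphM. Qed.

Lemma nu_mono (c : K) u : c != 0 ->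
  nu (theta (mono L c u)) = rval R c - \sum_i (u 0 i)%:~R * val_point 0 i.
Proof.
move=> c0; rewrite theta_mono (valM nuP) ?theta_mono_neq0 ?oner_neq0 //.
rewrite nu_const //; congr (_ + _); rewrite -sumrN.
(* The value of a monomial with coefficient 1 is additive in the exponent, so the coordinates
   determine it. *)
have muB : zmod_morphism (fun u => nu (theta (mono L 1 u))).
  move=> v w /=; apply/eqP; rewrite -subr_eq opprK.
  rewrite -(valM nuP) ?theta_mono_neq0 ?oner_neq0 //.
  by rewrite -rmorphM monoM mulr1 subrK.
pose mu : {additive 'rV[int]_n -> R} :=
  HB.pack (fun u => nu (theta (mono L 1 u))) (GRing.isZmodMorphism.Build _ _ _ muB).
rewrite -[LHS]/(mu u) row_additive; apply: eq_bigr => i _.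
by rewrite mxE mulrN opprK mulrzl.
Qed.

(** This is the easy inclusion of the fundamental theorem of tropical geometry: a maximum attained
    only once would be a dominant term of the sum [theta g], which is zero. *)
Lemma valuation_trop (I : set A) : (forall g, I g -> theta g = 0) -> trop I val_point.
Proof.
move=> I0 g [/I0 tg g0]; have [X [gX gE]] := laurent_sum g.
have nuE u : g u != 0 -> nu (theta (mono L (g u) u)) = - trop_term val_point g u.
  by move=> gu; rewrite nu_mono // opprB.
have [u0 gu0] : exists u, g u != 0.
  by apply: contrapT => H; move/eqP: g0; apply; apply: seriesP => u;
     apply: contrapT => /eqP gu; apply: H; exists u.
have : exists2 u, u \in X & forall v, v \in X ->
    trop_term val_point g v <= trop_term val_point g u.
  have u0X : u0 \in X by rewrite gX.
  case: (@arg_maxP _ _ _ [` u0X]%fset xpredT (fun u => trop_term val_point g (val u)) isT)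
    => -[u uX] _ um; exists u => // v vX; exact: (um [` vX]%fset isT).
move=> [u uX umax]; have umax' : trop_max val_point g u.
  by split; [rewrite -gX|move=> v; rewrite -gX; exact: umax].
apply: contrapT => H; move: tg; rewrite gE rmorph_sum => /eqP; apply/negP.
apply: (val_sum_dom nuP (i := u) _ _ _ _).1 => //.
  by rewrite theta_mono_neq0 // -gX.
move=> v vX vu _; rewrite !nuE -?gX // ltrN2 ltNge; apply/negP => le.
apply: H; exists v, u; split=> //; split; first by rewrite -gX.
by move=> w; rewrite -gX => /umax/le_trans; exact.
Qed.

End ValuationTrop.

(** * The plane *)

Section LinearPoly.
Context (n : nat) (K : fieldType).
Local Notation L := (laurent_supports n).

Definition linear_form (c0 : K) (c : 'rV[K]_n) : laurent n K :=
  mono L c0 0 + \sum_i mono L (c 0 i) (delta_mx 0 i).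

Lemma delta_row_eq (i j : 'I_n) :
  (delta_mx 0 i == delta_mx 0 j :> 'rV[int]_n) = (i == j).
Proof.
apply/eqP/eqP => [/matrixP/(_ 0 i)|->//].
by rewrite !mxE !eqxx /=; case: eqP.
Qed.

Lemma delta_row_neq0 (i : 'I_n) : (delta_mx 0 i == 0 :> 'rV[int]_n) = false.
Proof. by apply/eqP => /matrixP/(_ 0 i); rewrite !mxE !eqxx. Qed.

Variables (c0 : K) (c : 'rV[K]_n).

Lemma linear_form0 : linear_form c0 c 0 = c0.
Proof.
rewrite /linear_form Defs.coefD coef_sum /= eqxx big1 ?addr0 // => i _.
by rewrite eq_sym delta_row_neq0.
Qed.

Lemma linear_form_delta i : linear_form c0 c (delta_mx 0 i) = c 0 i.
Proof.
rewrite /linear_form Defs.coefD coef_sum /= delta_row_neq0 add0r.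
rewrite (bigD1 i) //= eqxx big1 ?addr0 // => j /negPf ji.
by rewrite delta_row_eq eq_sym ji.
Qed.

Lemma linear_form_supp u : linear_form c0 c u != 0 ->
  u = 0 \/ exists i, u = delta_mx 0 i.
Proof.
have [->|u0] := eqVneq u 0; first by left.
move=> H; right; apply: contrapT => N; move: H.
rewrite /linear_form Defs.coefD coef_sum /= (negPf u0) add0r big1 ?eqxx // => i _.
by case: eqP => // uE; case: N; exists i.
Qed.

End LinearPoly.

(** * Cones in dimension three and points of the standard plane *)

Section Cones.
Context (R : realType).
Implicit Types (u v : 'rV[int]_3) (w : 'rV[R]_3).

Lemma cone1P u w : cone [:: u] w <-> exists2 a : R, 0 <= a & w = a *: map_mx intr u.
Proof.
split=> [[a a0 ->]|[a a0 ->]].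
  by exists (a ord0) => //; rewrite /conic big_ord_recr big_ord0 /= add0r /=;
     congr (a _ *: _); apply: val_inj.
by exists (fun=> a) => //; rewrite /conic big_ord_recr big_ord0 /= add0r.
Qed.

Lemma cone2P u v w : cone [:: u; v] w <->
  exists a b : R, [/\ 0 <= a, 0 <= b & w = a *: map_mx intr u + b *: map_mx intr v].
Proof.
split=> [[a a0 ->]|[a [b [a0 b0 ->]]]].
  exists (a ord0), (a ord_max); split=> //; rewrite /conic !big_ord_recr big_ord0 /= add0r /=.
  by congr (a _ *: _ + a _ *: _); apply: val_inj.
exists (fun i => if i == ord0 then a else b); first by move=> i; case: ifP.
by rewrite /conic !big_ord_recr big_ord0 /= add0r.
Qed.

Definition o0 : 'I_3 := ord0.
Definition o1 : 'I_3 := @Ordinal 3 1 isT.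
Definition o2 : 'I_3 := ord_max.

Lemma ord3P (i : 'I_3) : [\/ i = o0, i = o1 | i = o2].
Proof.
case: i => -[|[|[|//]]] lt; [constructor 1|constructor 2|constructor 3];
  by apply: val_inj.
Qed.

Lemma row3P (T : Type) (x y : 'rV[T]_3) :
  x 0 o0 = y 0 o0 -> x 0 o1 = y 0 o1 -> x 0 o2 = y 0 o2 -> x = y.
Proof. by move=> h0 h1 h2; apply/rowP => i; case: (ord3P i) => ->. Qed.

Lemma vec3E (a b c : int) : ((vec3 a b c 0 o0 = a) * (vec3 a b c 0 o1 = b) *
  (vec3 a b c 0 o2 = c))%type.
Proof. by split; [split|]; rewrite mxE. Qed.

Lemma sum3 (V : nmodType) (F : 'I_3 -> V) : \sum_i F i = F o0 + F o1 + F o2.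
Proof.
rewrite !big_ord_recr big_ord0 /= add0r /=.
by congr (F _ + F _ + F _); apply: val_inj.
Qed.

(** For [s >= 0] these points lie in the cone of two negative coordinate rays. For large [s], only
    the constant term and the term of index [j] of a linear form can be maximal there. *)
Definition hub (s : R) (j : 'I_3) : 'rV[R]_3 := \row_i if i == j then 0 else - s.

Lemma hub_std_plane s j : 0 <= s -> fan_supp std_plane (hub s j).
Proof.
move=> s0; case: (ord3P j) => ->.
- exists ([:: vec3 0 (-1) 0; vec3 0 0 (-1)], 1%N); first by rewrite !inE eqxx !orbT.
  apply/cone2P; exists s, s; split=> //.
  apply: row3P; rewrite !mxE /= //=; ring.
- exists ([:: vec3 (-1) 0 0; vec3 0 0 (-1)], 1%N); first by rewrite !inE eqxx !orbT.
  apply/cone2P; exists s, s; split=> //.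
  apply: row3P; rewrite !mxE /= //=; ring.
- exists ([:: vec3 (-1) 0 0; vec3 0 (-1) 0], 1%N); first by rewrite !inE eqxx !orbT.
  apply/cone2P; exists s, s; split=> //.
  apply: row3P; rewrite !mxE /= //=; ring.
Qed.

Lemma std_plane_neqT : fan_supp std_plane <> [set: 'rV[R]_3].
Proof.
(* The test point is (3, 2, 1), where the maximum of 0 and the coordinates is attained only once. *)
move=> /seteqP[_ /(_ (\row_i (3 - i%:R)) I)] [s].
rewrite !inE => sV /=.
have cone_coord u v : cone [:: u; v] (\row_i (3 - i%:R) : 'rV[R]_3) ->
    exists a b : R, [/\ 0 <= a, 0 <= b, 3 = a * (u 0 o0)%:~R + b * (v 0 o0)%:~R,
      2 = a * (u 0 o1)%:~R + b * (v 0 o1)%:~R & 1 = a * (u 0 o2)%:~R + b * (v 0 o2)%:~R].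
  move=> /cone2P[a [b [a0 b0 /rowP E]]]; exists a, b.
  have := E o0; have := E o1; have := E o2; rewrite !mxE /=.
  by split=> //; lra.
by case/or4P: sV => [||| /or3P[]] /eqP -> /cone_coord[a [b []]];
  rewrite !vec3E; lra.
Qed.

End Cones.

(** * An equation of the plane with coefficients of equal valuation *)

Section PlaneEquation.
Context (R : realType) (k : closedFieldType).
Local Notation K := (puiseux k).
Local Notation v := (@rval k R).

Lemma trop_term0 n (w : 'rV[R]_n) (f : laurent n K) :
  trop_term w f 0 = - v (f 0).
Proof. by rewrite /trop_term big1 ?sub0r // => i _; rewrite mxE mul0r. Qed.

Lemma trop_term_delta n (w : 'rV[R]_n) (f : laurent n K) i :
  trop_term w f (delta_mx 0 i) = w 0 i - v (f (delta_mx 0 i)).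
Proof.
rewrite /trop_term (bigD1 i) //= mxE !eqxx mul1r big1 ?addr0 // => j /negPf ji.
by rewrite mxE eqxx ji mul0r.
Qed.

(** Far out, the maximum must be attained at both of the exponents 0 and [delta_mx 0 j], which
    forces equal valuations. *)
Lemma hub_coef (c0 : K) (c : 'rV[K]_3) (j : 'I_3) :
  (forall s : R, 0 <= s -> trop_hypersurface (linear_form c0 c) (hub s j)) ->
  c0 != 0 \/ c 0 j != 0 -> [/\ c0 != 0, c 0 j != 0 & pval (c 0 j) = pval c0].
Proof.
move=> H cc; set f := linear_form c0 c in H.
have f0 : f 0 = c0 by exact: linear_form0.
have fd i : f (delta_mx 0 i) = c 0 i by exact: linear_form_delta.
have [m mP] := @seq_lbound R _ (fun i : 'I_3 => v (c 0 i)).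
(* For this [s] the remaining terms, at most [- s - m], lie below both candidates. *)
pose s : R := `|m| + `|v c0| + `|v (c 0 j)| + 1.
have s0 : 0 <= s by rewrite !addr_ge0.
have [u [u' [uu' [fu umax] [fu' umax']]]] := H s s0.
have tz : trop_term (hub s j) f 0 = - v c0 by rewrite trop_term0 f0.
have tj : trop_term (hub s j) f (delta_mx 0 j) = - v (c 0 j).
  by rewrite trop_term_delta mxE eqxx fd sub0r.
have ti i : i != j -> trop_term (hub s j) f (delta_mx 0 i) <= - s - m.
  by move=> /negPf ij; rewrite trop_term_delta mxE ij fd lerD2l lerN2 mP.
have only x : f x != 0 -> (forall y, f y != 0 ->
    trop_term (hub s j) f y <= trop_term (hub s j) f x) -> x = 0 \/ x = delta_mx 0 j.
  move=> fx xmax; have [|[i xE]] := linear_form_supp fx; first by left.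
  have [ij|ij] := eqVneq i j; first by right; rewrite xE ij.
  exfalso; have := ti _ ij; rewrite -xE => {xE}.
  have := ler_norm (- m); have := ler_norm (v c0); have := ler_norm (v (c 0 j)).
  have := normr_ge0 (v c0); have := normr_ge0 (v (c 0 j)).
  rewrite normrN; case: cc => nz.
    by have := xmax 0; rewrite f0 tz => /(_ nz); rewrite /s; lra.
  by have := xmax (delta_mx 0 j); rewrite fd tj => /(_ nz); rewrite /s; lra.
suff [[fz zmax] [fj jmax]] : trop_max (hub s j) f 0 /\ trop_max (hub s j) f (delta_mx 0 j).
  move: fz fj (zmax _ fj) (jmax _ fz); rewrite tz tj f0 fd !lerN2 !ler_rat => -> -> h h'.
  by split=> //; apply/le_anti; rewrite h h'.
have [uE|uE] := only _ fu umax; have [uE'|uE'] := only _ fu' umax'; subst u u'.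
- by rewrite eqxx in uu'.
- by split; split.
- by split; split.
- by rewrite eqxx in uu'.
Qed.

Lemma trop_set1_0 n : trop [set 0 : laurent n K] = [set: 'rV[R]_n].
Proof. by apply/seteqP; split=> // w _ f [-> /eqP]. Qed.

Lemma plane_equation (IV : set (laurent 3 K)) :
  plane IV -> trop IV = fan_supp (R := R) std_plane ->
  exists (c0 : K) (c : 'rV[K]_3), [/\ IV (linear_form c0 c), c0 != 0 &
    forall i, c 0 i != 0 /\ pval (c 0 i) = pval c0].
Proof.
move=> [[gens gens_lin IVE] _] tropV.
have gensIV : gens `<=` IV by rewrite IVE; exact: sub_smallest.
(* If all generators vanished, the ideal would be zero and its tropicalisation the whole space. *)
have [f fg f0] : exists2 f, gens f & f != 0.
  apply: contrapT => H; apply: (@std_plane_neqT R); rewrite -tropV -(trop_set1_0 3).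
  congr trop; apply/seteqP; split; rewrite IVE.
    apply: smallest_sub => [|g gg]; last by apply: contrapT => /eqP g0; apply: H; exists g.
    by split=> // a u u' -> ->; rewrite mulr0 addr0.
  by move=> _ -> J [[]].
have [c0 [c fE]] := gens_lin _ fg; rewrite -/(linear_form c0 c) in fE.
have hubs j (s : R) : 0 <= s -> trop_hypersurface (linear_form c0 c) (hub s j).
  by move=> /(hub_std_plane j); rewrite -tropV -fE; apply; split=> //; exact: gensIV.
(* Were the constant term zero, some other coefficient would be nonzero, and [hub_coef] at its index
   gives a contradiction. *)
have c00 : c0 != 0.
  have [c00|//] := eqVneq c0 0; have [i ci] : exists i, c 0 i != 0.
    apply: contrapT => H; move/eqP: f0; apply; apply: seriesP => u.
    apply: contrapT => /eqP fu; move: (fu); rewrite fE => /linear_form_supp[|[i]] uE.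
      by move: fu; rewrite fE uE linear_form0 c00 eqxx.
    by apply: H; exists i; move: fu; rewrite fE uE linear_form_delta.
  by have [] := hub_coef (hubs i) (or_intror ci); rewrite c00 eqxx.
exists c0, c; split=> // [|i]; first by rewrite -fE; exact: gensIV.
by have [] := hub_coef (hubs i) (or_introl c00).
Qed.

End PlaneEquation.

(** * Dominant monomials at a point *)

Section Dominance.
Context (R : realType) (k : closedFieldType) (n : nat) (w : 'rV[R]_n).
Local Notation K := (puiseux k).
Local Notation A := (laurent n K).
Local Notation L := (laurent_supports n).
Local Notation v := (@rval k R).
Let vP := puiseux_valuation k R.

Definition dot (u : 'rV[int]_n) : R := \sum_i (u 0 i)%:~R * w 0 i.

(** This bounds by [M] the logarithm of the Gauss norm of [g] at [w]; zero coefficients impose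
    nothing. *)
Definition trop_le (M : R) (g : A) := forall u, val_ge v (dot u - M) (g u).
Definition trop_lt (M : R) (g : A) := forall u, val_gt v (dot u - M) (g u).

Lemma dotD u u' : dot (u + u') = dot u + dot u'.
Proof. by rewrite -big_split; apply: eq_bigr => i _; rewrite mxE rmorphD mulrDl. Qed.

Lemma dotMn u m : dot (u *+ m) = m%:R * dot u.
Proof.
elim: m => [|m IH].
  by rewrite mul0r /dot big1 // => i _; rewrite mxE mul0r.
by rewrite mulrS dotD IH -natr1; ring.
Qed.

Lemma trop_ltD M g g' : trop_lt M g -> trop_lt M g' -> trop_lt M (g + g').
Proof. by move=> gM gM' u; rewrite Defs.coefD; exact: (val_gtD vP). Qed.

Lemma trop_lt_sum M (I : Type) (r : seq I) (P : pred I) (F : I -> A) :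
  (forall i, P i -> trop_lt M (F i)) -> trop_lt M (\sum_(i <- r | P i) F i).
Proof.
by move=> FM; elim/big_ind: _ => //; [move=> u; rewrite /val_gt eqxx|exact: trop_ltD].
Qed.

Lemma trop_ltW M g : trop_lt M g -> trop_le M g.
Proof. by move=> gM u gu; exact/ltW/gM. Qed.

Lemma trop_le_lt M M' g : trop_le M g -> M < M' -> trop_lt M' g.
Proof. by move=> gM MM' u gu; apply: lt_le_trans (gM _ gu); rewrite ltrD2l ltrN2. Qed.

Lemma trop_le_mono (c : K) u : trop_le (dot u - v c) (mono L c u).
Proof.
move=> u' /=; have [->|_] := eqVneq u' u; last by rewrite /val_ge eqxx.
by move=> _; rewrite subKr.
Qed.

(** The Gauss norm is submultiplicative, and strictness of one bound is inherited. *)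
Lemma trop_leM M M' g g' : trop_le M g -> trop_lt M' g' -> trop_lt (M + M') (g * g').
Proof.
move=> gM gM' u; have /finite_fsetP[X XE] := conv_support g g' u.
rewrite -[(g * g') u]/(conv g g' u) (@convE _ _ _ _ _ X); last first.
  by move=> y gy gy'; have /= <- := congr1 (@^~ y) XE.
apply: (val_gt_sum vP) => y _ ggy.
have gy : g y != 0 by apply: contraNneq ggy => ->; rewrite mul0r.
have gy' : g' (u - y) != 0 by apply: contraNneq ggy => ->; rewrite mulr0.
rewrite (valM vP) //; have := gM _ gy; have := gM' _ gy'.
by have := dotD (u - y) y; rewrite subrK; lra.
Qed.

(** The term at [u] alone attains the maximum. *)
Lemma dominant_not_trop g (c : K) u : c != 0 ->
  trop_lt (dot u - v c) (g - mono L c u) -> g != 0 /\ ~ trop_hypersurface g w.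
Proof.
move=> c0 gM; have [r rM gE] : exists2 r, trop_lt (dot u - v c) r & g = mono L c u + r.
  by exists (g - mono L c u) => //; rewrite addrC subrK.
have gu : g u != 0 /\ v (g u) = v c.
  rewrite gE Defs.coefD /= eqxx; apply: (val_add_dom vP) => // ru.
  by have := rM _ ru; rewrite subKr.
have gE' u' : u' != u -> g u' = r u'.
  by move=> /negPf uu'; rewrite gE Defs.coefD /= uu' add0r.
split; first by apply/eqP => g0; move: gu.1; rewrite g0 eqxx.
have only x : trop_max w g x -> x = u.
  move=> [gx xmax]; apply/eqP; apply: contrapT => /negP xu.
  have := xmax _ gu.1; rewrite -[trop_term w g u]/(dot u - v (g u)) gu.2.
  rewrite -[trop_term w g x]/(dot x - v (g x)).
  by have := rM x; rewrite -gE' // => /(_ gx); lra.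
by move=> [x [y [/eqP xy /only xu /only yu]]]; apply: xy; rewrite xu yu.
Qed.

Lemma dominantX g (c : K) u m : c != 0 ->
  trop_lt (dot u - v c) (g - mono L c u) ->
  trop_lt (m%:R * (dot u - v c)) (g ^+ m - mono L (c ^+ m) (u *+ m)).
Proof.
move=> c0 gM; elim: m => [|m IH].
  by rewrite expr0 expr0 mulr0n subrr => u'; rewrite /val_gt eqxx.
(* A telescoping identity; the second factor [g] is split so that [leM] can bound it. *)
have -> : g ^+ m.+1 - mono L (c ^+ m.+1) (u *+ m.+1) =
    mono L (c ^+ m) (u *+ m) * (g - mono L c u)
    + (mono L c u + (g - mono L c u)) * (g ^+ m - mono L (c ^+ m) (u *+ m)).
  rewrite exprSr [mono L (c ^+ m.+1) _](_ : _ = mono L (c ^+ m) (u *+ m) * mono L c u).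
    by ring.
  by rewrite monoM -exprSr -mulrSr.
have leX : trop_le (m%:R * (dot u - v c)) (mono L (c ^+ m) (u *+ m)).
  have := @trop_le_mono (c ^+ m) (u *+ m).
  by rewrite dotMn (valX vP) // -mulrBr.
have leM : trop_le (dot u - v c) (mono L c u + (g - mono L c u)).
  move=> u'; rewrite Defs.coefD; apply: (val_geD vP); first exact: trop_le_mono.
  exact: trop_ltW.
rewrite -natr1 mulrDl mul1r; apply: trop_ltD; first exact: trop_leM.
by rewrite addrC; exact: trop_leM.
Qed.

End Dominance.

(** * The curve *)

Lemma vec3D (a b c a' b' c' : int) :
  vec3 a b c + vec3 a' b' c' = vec3 (a + a') (b + b') (c + c').
Proof. by apply: row3P; rewrite !mxE. Qed.

Lemma delta_vec3 : ((delta_mx 0 o0 = vec3 1 0 0) * (delta_mx 0 o1 = vec3 0 1 0) *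
  (delta_mx 0 o2 = vec3 0 0 1))%type.
Proof. by split; [split|]; apply: row3P; rewrite !mxE. Qed.

Lemma dot_vec3 (R : realType) (w : 'rV[R]_3) a b c : dot w (vec3 a b c) =
  a%:~R * w 0 o0 + b%:~R * w 0 o1 + c%:~R * w 0 o2.
Proof. by rewrite /dot sum3 !vec3E. Qed.

Lemma row_int_ind (n : nat) (Q : 'rV[int]_n -> Prop) :
  (forall u u', Q u -> Q u' -> Q (u - u')) -> Q 0 ->
  (forall i, Q (delta_mx 0 i)) -> forall u, Q u.
Proof.
move=> QB Q0 Qd u.
have QN u' : Q u' -> Q (- u') by rewrite -sub0r; exact: QB.
have QD u1 u2 : Q u1 -> Q u2 -> Q (u1 + u2).
  by move=> Q1 Q2; rewrite -[u2]opprK; exact/QB/QN.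
have Qn u' m : Q u' -> Q (u' *+ m).
  by move=> Qu; elim: m => // m IH; rewrite mulrS; exact: QD.
rewrite (row_sum_delta u); elim/big_ind: _ => // i _.
rewrite -[u 0 i]intz scaler_int; case: (u 0 i) => m; first exact/Qn/Qd.
by rewrite NegzE mulrNz; exact/QN/Qn/Qd.
Qed.

Section Curve.
Context (R : realType) (k : closedFieldType) (d : int) (d_ge3 : 3 <= d).
Local Notation K := (puiseux k).
Local Notation L := (laurent_supports 3).
Local Notation A := (laurent 3 K).
Local Notation v := (@rval k R).
Local Notation kc := (@const _ L K).
Let vP := puiseux_valuation k R.

Context (I : set A) (idealI : ideal I).
Hypothesis tropI : trop I = fan_supp (R := R) (three_rays d).
Context (c0 : K) (c : 'rV[K]_3).
Hypothesis fI : I (linear_form c0 c).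
Hypothesis c0_neq0 : c0 != 0.
Hypothesis c_neq0 : forall i, c 0 i != 0.
Hypothesis vc : forall i, v (c 0 i) = v c0.

(* With x_1, x_2, x_3 the coordinates of the torus, this is
   x_1 (c_1 x_1 + c_2 x_2) / x_2, where c_1 x_1 + c_2 x_2 is the equation of the
   line joining the two singular points of the closure of the curve. *)
Definition obstruction : A :=
  mono L (c 0 o0) (vec3 2 (-1) 0) + mono L (c 0 o1) (vec3 1 0 0).
Local Notation h := obstruction.

Let d_ge3R : 3 <= d%:~R :> R.
Proof. by rewrite (_ : 3 = 3%:~R) // ler_int. Qed.

Lemma three_raysP (w : 'rV[R]_3) : fan_supp (three_rays d) w ->
  exists2 s : R, 0 <= s &
    [\/ [/\ w 0 o0 = 0, w 0 o1 = s & w 0 o2 = s],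
        [/\ w 0 o0 = (1 - d%:~R) * s, w 0 o1 = - d%:~R * s & w 0 o2 = 0] |
        [/\ w 0 o0 = (d%:~R - 1) * s, w 0 o1 = (d%:~R - 1) * s & w 0 o2 = - s]].
Proof.
move=> [s]; rewrite !inE => /or3P[] /eqP -> /cone1P[a a0 ->]; exists a => //.
- by constructor 1; rewrite !mxE /=; split; ring.
- by constructor 2; rewrite !mxE /= !rmorphB ?rmorphN /=; split; ring.
- by constructor 3; rewrite !mxE /= !rmorphB ?rmorphN /=; split; ring.
Qed.

Lemma second_ray (s : R) : 0 <= s ->
  fan_supp (three_rays d) (s *: map_mx intr (vec3 (1 - d) (- d) 0)).
Proof.
move=> s0; exists ([:: vec3 (1 - d) (- d) 0], 1%N); first by rewrite !inE eqxx orbT.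
by apply/cone1P; exists s.
Qed.

(* Along the second ray h is dominated by its term in x_1^2 / x_2, which tends
   to 0: this is where d >= 3 is used. *)
Lemma obstruction_transcendental (p : {poly K}) : p != 0 ->
  ~ I (map_poly kc p).[h].
Proof.
move=> p0 Iph.
(* Since [h] is small far along the ray, the lowest power with nonzero coefficient dominates [p]
   evaluated at [h]. *)
have [i0 pi0 i0min] : exists2 i, p`_i != 0 & forall j, (j < i)%N -> p`_j = 0.
  have : exists i, p`_i != 0 by exists (size p).-1; rewrite -lead_coefE lead_coef_eq0.
  case/ex_minnP => i pi imin; exists i => // j ji; apply: contrapT => /eqP/imin.
  by rewrite leqNgt ji.
have [m mP] := @seq_lbound R _ (fun i : 'I_(size p) => v p`_i).
(* The second condition will make [M], the logarithmic size of [h], negative; the third makes it too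
   small for higher powers to compete, whatever their coefficients in [p]. *)
have [s [s0 sv0 svm]] : exists s : R,
    [/\ 0 < s, - v c0 < s & v p`_i0 - m - v c0 < s].
  exists (1 + `|v c0| + `|v p`_i0 - m - v c0|).
  have := normr_ge0 (v c0); have := normr_ge0 (v p`_i0 - m - v c0).
  have := ler_norm (v p`_i0 - m - v c0); have := ler_norm (- v c0).
  by rewrite normrN; split; lra.
pose w : 'rV[R]_3 := s *: map_mx intr (vec3 (1 - d) (- d) 0).
have wB : trop I w by rewrite tropI; apply: second_ray; exact: ltW.
pose a := vec3 2 (-1) 0; pose M := dot w a - v (c 0 o0).
have w0 : w 0 o0 = (1 - d%:~R) * s by rewrite !mxE /= rmorphB /=; ring.
have w1 : w 0 o1 = - d%:~R * s by rewrite !mxE /= rmorphN /=; ring.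
have ME : M = (2 - d%:~R) * s - v c0 by rewrite /M dot_vec3 vc w0 w1 /=; ring.
have Ms : M <= - s - v c0.
  have : 0 <= (d%:~R - 3) * s by rewrite mulr_ge0 ?subr_ge0 // ltW.
  by rewrite ME lerD2r; lra.
have Mneg : M < 0 by lra.
have Mlow : M < m - v p`_i0 by lra.
(* The other monomial of [h] is lower by [s] at [w]. *)
have hM : trop_lt w M (h - mono L (c 0 o0) a).
  rewrite /obstruction addrC addKr; apply: trop_le_lt (@trop_le_mono _ _ _ _ _ _) _.
  by rewrite dot_vec3 vc ME w0 w1 /=; lra.
have hX i := @dominantX _ _ _ _ _ _ _ i (c_neq0 o0) hM.
have term_le i : trop_le w (i%:R * M - v p`_i) (mono L (p`_i * c 0 o0 ^+ i) (a *+ i)).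
  move=> u pu; have [pi pc] : p`_i != 0 /\ c 0 o0 ^+ i != 0.
    apply/andP; rewrite -negb_or -mulf_eq0.
    by apply: contraNneq pu => /= ->; rewrite if_same.
  have := trop_le_mono w pu; rewrite dotMn (valM vP) // (valX vP) // /M.
  by move: pu => /= ; lra.
have term_lt i : trop_lt w (i%:R * M - v p`_i)
    (kc p`_i * h ^+ i - mono L (p`_i * c 0 o0 ^+ i) (a *+ i)).
  have -> : mono L (p`_i * c 0 o0 ^+ i) (a *+ i) = kc p`_i * mono L (c 0 o0 ^+ i) (a *+ i).
    by rewrite /const monoM add0r.
  rewrite -mulrBr addrC; apply: trop_leM (hX i).
  have := @trop_le_mono _ _ _ w p`_i 0.
  by rewrite /dot big1 ?sub0r // => j _; rewrite mxE mul0r.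
have lt_size : (i0 < size p)%N by rewrite ltnNge; apply: contra pi0 => /(nth_default 0) ->.
have cdot : dot w (a *+ i0) - v (p`_i0 * c 0 o0 ^+ i0) = i0%:R * M - v p`_i0.
  by rewrite dotMn (valM vP) ?expf_neq0 // (valX vP) // /M; ring.
have [g0 gw] : (map_poly kc p).[h] != 0 /\ ~ trop_hypersurface (map_poly kc p).[h] w.
  apply: (@dominant_not_trop _ _ _ _ _ (p`_i0 * c 0 o0 ^+ i0) (a *+ i0)).
    by rewrite mulf_neq0 ?expf_neq0.
  rewrite cdot horner_coef size_map_poly (bigD1 (Ordinal lt_size)) //= coef_map /= addrAC.
  apply: trop_ltD; first exact: term_lt.
  apply: trop_lt_sum => i ii0; rewrite coef_map /=.
  have [ilt|igt|ieq] := ltngtP i i0.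
  - by rewrite (i0min _ ilt) rmorph0 mul0r => u; rewrite /val_gt eqxx.
  - rewrite -(subrK (mono L (p`_i * c 0 o0 ^+ i) (a *+ i)) (kc p`_i * _)).
    (* Each power above [i0] gains at least one more factor of size [M], and [M] lies below
       [m - v p_i0], with p_i0 the coefficient at [i0]. *)
    have lt : i%:R * M - v p`_i < i0%:R * M - v p`_i0.
      have : i%:R * M <= (i0%:R + 1) * M by rewrite ler_nM2r // natr1 ler_nat.
      by have := mP i; rewrite mulrDl; lra.
    by apply: trop_ltD; [exact/trop_le_lt/lt/trop_ltW|exact: trop_le_lt lt].
  - by case/eqP: ii0; apply: val_inj.
by apply: gw; apply: wB.
Qed.

(** * Values of [h] at points of the curve *)

Section Evaluation.
Context (E : fieldType) (theta : {rmorphism A -> E}).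
Hypothesis thetaI : forall g, I g -> theta g = 0.

Local Notation X i := (theta (mono L 1 (delta_mx 0 i))).
Local Notation C c := (theta (kc c)).

(** The equation of the plane, multiplied by x_1 / x_2, gives a second expression of [h], suited to
    the third ray. *)
Lemma obstructionE : theta h = - theta (mono L c0 (vec3 1 (-1) 0)
  + mono L (c 0 o2) (vec3 1 (-1) 1)).
Proof.
apply/eqP; rewrite -addr_eq0 -rmorphD.
have -> : h + (mono L c0 (vec3 1 (-1) 0) + mono L (c 0 o2) (vec3 1 (-1) 1)) =
    mono L 1 (vec3 1 (-1) 0) * linear_form c0 c.
  rewrite /linear_form sum3 !delta_vec3 !mulrDr !monoM !mul1r !vec3D /= addr0.
  by rewrite /obstruction; ring.
by rewrite rmorphM (thetaI fI) mulr0.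
Qed.

(** The point [w] lies on one of the three rays. Both monomials of [h] pair nonpositively with the
    first two rays, and both monomials of [obstructionE] with the third. *)
Lemma obstruction_bounded (nu : E -> R) : valuation nu ->
  (forall a : K, a != 0 -> nu (theta (kc a)) = v a) -> val_ge nu (v c0) (theta h).
Proof.
move=> nuP nu_const.
have := valuation_trop nuP nu_const thetaI; rewrite tropI.
set w := val_point _ _ => /three_raysP[s s0 sw].
have mono_ge (a : K) u : a != 0 -> v a = v c0 -> dot w u <= 0 ->
    val_ge nu (v c0) (theta (mono L a u)).
  by move=> a0 av wu _; rewrite (nu_mono nuP nu_const) // av -/(dot w u); lra.
case: sw => [[w0 w1 w2]|[w0 w1 w2]|[w0 w1 w2]].
- rewrite /obstruction rmorphD; apply: (val_geD nuP); apply: mono_ge => //;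
    by rewrite dot_vec3 w0 w1 w2 /=; lra.
- have ds : 0 <= (d%:~R - 3) * s by rewrite mulr_ge0 ?subr_ge0.
  rewrite /obstruction rmorphD; apply: (val_geD nuP); apply: mono_ge => //;
    by rewrite dot_vec3 w0 w1 w2 /=; lra.
rewrite obstructionE -rmorphN opprD rmorphD -!monoN.
apply: (val_geD nuP); apply: mono_ge; rewrite ?oppr_eq0 ?(valN vP) //;
  by rewrite dot_vec3 w0 w1 w2 /=; lra.
Qed.

(** With t = x_2 / x_1, one has h = x_1 (c_1 / t + c_2). This gives x_1, then x_2 = t x_1, and the
    equation of the plane gives x_3. *)
Lemma eval_algebraic (F : fieldType) (kappa : {rmorphism F -> E}) :
  (forall a, algebraicOver kappa (C a)) -> algebraicOver kappa (theta h) ->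
  theta h != 0 -> algebraicOver kappa (X o1 / X o0) ->
  forall g, algebraicOver kappa (theta g).
Proof.
move=> algC algh h0 algt.
have X0 i : X i != 0 by apply: theta_mono_neq0; exact: oner_neq0.
have hE : theta h = X o0 * (C (c 0 o0) / (X o1 / X o0) + C (c 0 o1)).
  have aE : theta (mono L (c 0 o0) (vec3 2 (-1) 0)) * X o1 = C (c 0 o0) * X o0 ^+ 2.
    by rewrite theta_mono -mulrA expr2 -!theta_monoD !delta_vec3 !vec3D.
  have bE : theta (mono L (c 0 o1) (vec3 1 0 0)) = C (c 0 o1) * X o0.
    by rewrite theta_mono delta_vec3.
  rewrite /obstruction rmorphD bE -[theta (mono L (c 0 o0) _)](mulfK (X0 o1)) aE.
  by field; rewrite !X0.
have alg0 : algebraicOver kappa (X o0).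
  have nz : C (c 0 o0) / (X o1 / X o0) + C (c 0 o1) != 0.
    by apply: contra_neq h0; rewrite hE => ->; rewrite mulr0.
  rewrite -(mulfK nz (X o0)) -hE; apply: algebraic_div => //.
  by apply: algebraic_add => //; exact: algebraic_div.
have alg1 : algebraicOver kappa (X o1).
  by rewrite -(divfK (X0 o0) (X o1)); exact: algebraic_mul.
have alg2 : algebraicOver kappa (X o2).
  have c2 : C (c 0 o2) != 0 by rewrite theta_mono_neq0.
  have : theta (linear_form c0 c) = 0 by exact: thetaI.
  rewrite /linear_form sum3 !rmorphD (theta_mono theta _ (delta_mx 0 o0)).
  rewrite (theta_mono theta _ (delta_mx 0 o1)) (theta_mono theta _ (delta_mx 0 o2)) => /eqP.
  rewrite !addrA addr_eq0 => /eqP E2.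
  rewrite -(mulKf c2 (X o2)) -[C _ * X o2]opprK -E2 mulrC.
  apply: algebraic_div => //; apply: algebraic_opp.
  apply: algebraic_add; last exact: algebraic_mul.
  by apply: algebraic_add; [exact: algC|exact: algebraic_mul].
have algX : forall u, algebraicOver kappa (theta (mono L 1 u)).
  apply: row_int_ind.
  - move=> u u' algu algu'.
    have -> : theta (mono L 1 (u - u')) = theta (mono L 1 u) / theta (mono L 1 u').
      apply: (canRL (mulfK _)); first by apply: theta_mono_neq0; exact: oner_neq0.
      by rewrite -theta_monoD subrK.
    exact: algebraic_div.
  - by have := algC 1.
  - by move=> i; case: (ord3P i) => ->.
move=> g; have [Y [_ ->]] := laurent_sum g; rewrite rmorph_sum.
elim/big_ind: _ => [||u _]; [exact: algebraic0|exact: algebraic_add|].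
by rewrite theta_mono; exact: algebraic_mul.
Qed.

End Evaluation.

Lemma no_curve : False.
Proof.
(* A prime ideal containing [I] and disjoint from [S] is a point of the curve at which [h] is
   transcendental over [K]. *)
pose S := [set g | exists2 p : {poly K}, p != 0 & g = (map_poly kc p).[h]].
have [||| P [PP IP PS]] := @prime_avoiding _ I S idealI.
- by exists 1; rewrite ?oner_neq0 // rmorph1 hornerC.
- move=> _ _ [p p0 ->] [q q0 ->]; exists (p * q); first exact: mulf_neq0.
  by rewrite rmorphM hornerM.
- by move=> _ [p p0 ->]; exact: obstruction_transcendental.
have [E [theta [thetaP thetaS]]] := prime_quotient_field PP.
have thetaI g : I g -> theta g = 0 by move=> /IP/thetaP.
have h_tr : ~ algebraicOver (theta \o kc) (theta h).
  move=> [p p0 /rootP ph]; apply: (PS (map_poly kc p).[h]); first by exists p.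
  by apply/thetaP; rewrite -horner_map -map_poly_comp.
have h0 : theta h != 0 by apply: contra_not_neq h_tr => ->; exact: algebraic0.
(* The auxiliary element is x_2 / x_1: by [eval_algebraic], [E] is algebraic over any subfield that
   contains the constants and [h] and over which this ratio is algebraic. *)
have [|nu nuP [nuC nuh]] := @two_step_valuation R K E (theta \o kc) v (theta h)
    (theta (mono L 1 (delta_mx 0 o1)) / theta (mono L 1 (delta_mx 0 o0)))
    (v c0 - 1) vP (@pval_dense k R) h_tr.
  move=> F j kappa jE [X XE] alg_t x; have [a [b ->]] := thetaS x.
  have alg g : algebraicOver kappa (theta g).
    apply: eval_algebraic => // [e|]; last by rewrite -XE; exact: algebraic_id.
    by rewrite -[theta _]jE; exact: algebraic_id.
  exact: algebraic_div.
have := obstruction_bounded thetaI nuP nuC h0; rewrite nuh; lra.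
Qed.

End Curve.

Theorem proposition4p5 (R : realType) (d : int) (d_ge1 : 1 <= d) (d_ge3 : 3 <= d) :
  forall k : closedFieldType, ~ realisable R k std_plane (three_rays d).
Proof.
move=> k [IV [IC [planeV [tropV _] [[idealC _] _ _] VC [tropC _]]]].
have [c0 [c [fV c00 cP]]] := plane_equation planeV tropV.
apply: (no_curve d_ge3 idealC tropC (VC _ fV) c00) => i; first exact: (cP i).1.
by rewrite /rval (cP i).2.
Qed.
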